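(* In the setting below, assume each $f_i$ is $L_i$-smooth, $f$ is $\mu_f$-strongly convex in the sense $B_f(x,y)\ge\frac{\mu_f}{2}\|x-y\|^2$ for all $x,y$, $\psi$ satisfies the $\mu_\psi$-condition, and $\mu_F:=\mu_f+2\mu_\psi>0$. Use the constant stepsize $\eta_k=\eta$ with $0<\eta\le\frac{1}{n\left(4\sqrt{2\bar LL^*(1+\log K)}\vee\mu_\psi\right)}$. Then there are absolute constants $C,c>0$ such that: (i) for arbitrary permutations $\sigma_k$, $$F(x_{K+1})-F_*\le C\left(\frac{D^2}{n\eta K}e^{-c\,n\eta\mu_FK}+\frac{n\eta\bar L\sigma^2_{\mathrm{any}}}{\mu_FK}+(n\eta)^2\bar L\sigma^2_{\mathrm{any}}(1+\log K)\right);$$ (ii) if each $\sigma_k$ is a uniformly random permutation, $$\mathbb E[F(x_{K+1})-F_*]\le C\left(\frac{D^2}{n\eta K}e^{-c\,n\eta\mu_FK}+\frac{\eta\bar L\sigma^2_{\mathrm{rand}}}{\mu_FK}+n\eta^2\bar L\sigma^2_{\mathrm{rand}}(1+\log K)\right).$$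
   Context: Setting. Let $n,d\in\mathbb N$, let $f_1,\dots,f_n:\mathbb R^d\to\mathbb R$ be convex, $f=\frac1n\sum_{i=1}^nf_i$, let $\psi:\mathbb R^d\to\mathbb R\cup\{+\infty\}$ be proper, closed and convex, and $F=f+\psi$. For a convex function $g$, $\nabla g(x)$ denotes an element of $\partial g(x)$ (for each $f_i$ a fixed selection of subgradients, the same one used in the algorithm; for differentiable $g$ it is the gradient), and $B_g(x,y)=g(x)-g(y)-\langle\nabla g(y),x-y\rangle$. The $\mu_\psi$-condition: $\mu_\psi\ge0$ and $B_\psi(x,y)\ge\frac{\mu_\psi}{2}\|x-y\|^2$ for all $x,y$ with $\partial\psi(y)\neq\emptyset$ and every choice of $\nabla\psi(y)\in\partial\psi(y)$. Assume there is $x_*\in\mathbb R^d$ with $F(x_* )=\inf_{x}F(x)\in\mathbb R$; write $F_*=F(x_* )$. Proximal shuffling gradient method: given $x_1\in\mathrm{dom}\,\psi$, a number of epochs $K\ge2$ and stepsizes $\eta_k>0$, for $k=1,\dots,K$: choose a permutation $\sigma_k=(\sigma_k^1,\dots,\sigma_k^n)$ of $[n]=\{1,\dots,n\}$; set $x_k^1=x_k$ and $x_k^{i+1}=x_k^i-\eta_k\nabla f_{\sigma_k^i}(x_k^i)$ for $i=1,\dots,n$; set $x_{k+1}=\arg\min_{x\in\mathbb R^d}\{n\psi(x)+\frac{1}{2\eta_k}\|x-x_k^{n+1}\|^2\}$. $D=\|x_*-x_1\|$; $\|\cdot\|$ is the Euclidean norm; $\log$ is natural; $a\vee b=\max\{a,b\}$,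 $a\wedge b=\min\{a,b\}$. Smoothness: each $f_i$ is differentiable with $\|\nabla f_i(x)-\nabla f_i(y)\|\le L_i\|x-y\|$ for all $x,y$, $L_i>0$; $\bar L=\frac1n\sum_iL_i$, $L^*=\max_iL_i$; $\sigma^2_{\mathrm{any}}=\frac1n\sum_{i=1}^n\|\nabla f_i(x_* )\|^2$, $\sigma^2_{\mathrm{rand}}=\sigma^2_{\mathrm{any}}+n\|\nabla f(x_* )\|^2$. Uniformly random permutation: each $\sigma_k$ is uniformly distributed over all permutations of $[n]$ (the joint dependence between different epochs is arbitrary); expectations are over the permutations. *)

(* Defs.v *)
From HB Require Import structures.
From mathcomp Require Import all_boot all_order all_algebra all_fingroup.
From mathcomp Require Import all_classical all_reals all_analysis.
Set Implicit Arguments. Unset Strict Implicit. Unset Printing Implicit Defensive.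
Import Order.TTheory GRing.Theory Num.Theory.
Import numFieldNormedType.Exports.
Local Open Scope ring_scope.

Section Defs.
Variables (R : realType) (d : nat).
Local Notation V := 'rV[R]_d.

Definition dotv (x y : V) : R := \sum_(j < d) x 0 j * y 0 j.
Definition enorm (x : V) : R := Num.sqrt (dotv x x).

Definition convex_fun (h : V -> R) : Prop :=
  forall (x y : V) (t : R), 0 < t < 1 -> h ((1 - t) *: x + t *: y) <= (1 - t) * h x + t * h y.

Definition convex_efun (h : V -> \bar R) : Prop :=
  forall (x y : V) (t : R), 0 < t < 1 ->
    (h ((1 - t) *: x + t *: y)%R <= (1 - t)%:E * h x + t%:E * h y)%E.

Definition proper_efun (h : V -> \bar R) : Prop :=
  (forall x, h x != -oo%E) /\ exists x, (h x < +oo)%E.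

Definition closed_efun (h : V -> \bar R) : Prop :=
  closed [set p : V * R | (h p.1 <= p.2%:E)%E].

Definition subgrad (h : V -> \bar R) (y g : V) : Prop :=
  forall x, (h y + (dotv g (x - y)%R)%:E <= h x)%E.

Definition has_gradient (h : V -> R) (gr : V -> V) : Prop :=
  forall x, differentiable h x /\ ('d h x : V -> R) = (fun v => dotv (gr x) v).

Definition lipschitz_map (gr : V -> V) (L : R) : Prop :=
  forall x y, enorm (gr x - gr y) <= L * enorm (x - y).

Definition mu_psi_condition (psi : V -> \bar R) (mu : R) : Prop :=
  0 <= mu /\ forall x y g, subgrad psi y g ->
    (psi y + (dotv g (x - y)%R + mu / 2 * enorm (x - y)%R ^+ 2)%:E <= psi x)%E.

Definition epoch_pass n (gr : 'I_n -> V -> V) (eta : R) (sigma : {perm 'I_n}) (x : V) : V :=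
  foldl (fun y i => y - eta *: gr (sigma i) y) x (enum 'I_n).

Definition is_prox_point (n : nat) (psi : V -> \bar R) (eta : R) (y z : V) : Prop :=
  forall w, ((n%:R)%:E * psi z + (enorm (z - y)%R ^+ 2 / (2 * eta))%:E
             <= (n%:R)%:E * psi w + (enorm (w - y)%R ^+ 2 / (2 * eta))%:E)%E.

Definition prox_shuffling_run n (gr : 'I_n -> V -> V) (psi : V -> \bar R) (eta : R)
    (K : nat) (sigma : nat -> {perm 'I_n}) (x1 : V) (x : nat -> V) : Prop :=
  x 1%N = x1 /\
  forall k, (1 <= k <= K)%N ->
    is_prox_point n psi eta (epoch_pass gr eta (sigma k) (x k)) (x k.+1).

End Defs.

(* Main.v *)
Require Import Defs.
From HB Require Import structures.
From mathcomp Require Import all_boot all_order all_algebra all_fingroup.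
From mathcomp Require Import all_classical all_reals all_analysis.
From mathcomp Require Import ring lra zify.
Import Order.TTheory GRing.Theory Num.Theory.
Import numFieldNormedType.Exports.
Local Open Scope ring_scope.
Set Implicit Arguments.
Unset Strict Implicit.
Unset Printing Implicit Defensive.

(** Write [N = n eta], [Lbar] for the mean smoothness constant and [x*] for the
    minimizer. Comparing one epoch [x -> x+] with a point [z] of the domain of
    [psi], smoothness, co-coercivity of the gradients and optimality of [x+] give
      [2 N (F x+ - F z) <= |z - x|^2 - (1 + N mu_psi) |z - x+|^2
                           + 2 N (a (F z - F x* ) + r)]
    with [a = 24 (N Lbar)^2] of order [1 / log K], and a residual [r] which depends
    on the permutation and on the gradients at [x*] only. Hence the expectation of
    [r] involves one marginal law at a time, and the dependence between epochs
    is irrelevant.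

    In the first half of the epochs take [z = x*]: growth of [F] at [x*] makes
    [|x_k - x*|^2] contract by [1 + N mu_F], up to residuals. In the second half
    compare the average gap of the last [k] iterates, through [z] the iterate just
    before them, with the average over the last [k + 1]; the accumulated factors
    [1 + a / (k + 1)] stay bounded and the residuals are summed with harmonic
    weights, which is the origin of the factor [1 + log K]. *)

(** * Inequalities for the Euclidean inner product *)

Section InnerProduct.
Context {R : realType} {d : nat}.
Implicit Types (x y z : 'rV[R]_d) (a : R).

Lemma dotvC x y : dotv x y = dotv y x.
Proof. by apply: eq_bigr => j _; rewrite mulrC. Qed.

Lemma dotvDl x y z : dotv (x + y) z = dotv x z + dotv y z.
Proof. by rewrite -big_split; apply: eq_bigr => j _; rewrite mxE mulrDl. Qed.

Lemma dotvZl a x y : dotv (a *: x) y = a * dotv x y.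
Proof. by rewrite /dotv mulr_sumr; apply: eq_bigr => j _; rewrite mxE mulrA. Qed.

Lemma dotvNl x y : dotv (- x) y = - dotv x y.
Proof. by rewrite -scaleN1r dotvZl mulN1r. Qed.

Lemma dotvDr x y z : dotv z (x + y) = dotv z x + dotv z y.
Proof. by rewrite dotvC dotvDl !(dotvC z). Qed.

Lemma dotvZr a x y : dotv y (a *: x) = a * dotv y x.
Proof. by rewrite dotvC dotvZl (dotvC y). Qed.

Lemma dotvNr x y : dotv y (- x) = - dotv y x.
Proof. by rewrite dotvC dotvNl (dotvC y). Qed.

Lemma dot0v x : dotv 0 x = 0.
Proof. by rewrite -(scale0r 0) dotvZl mul0r. Qed.

Lemma dotv_suml (I : Type) (r : seq I) (P : pred I) (v : I -> 'rV[R]_d) y :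
  dotv (\sum_(i <- r | P i) v i) y = \sum_(i <- r | P i) dotv (v i) y.
Proof.
elim/big_rec2 : _ => [|i u w _ <-]; first exact: dot0v.
by rewrite dotvDl.
Qed.

Lemma dotv_sumr (I : Type) (r : seq I) (P : pred I) (v : I -> 'rV[R]_d) y :
  dotv y (\sum_(i <- r | P i) v i) = \sum_(i <- r | P i) dotv y (v i).
Proof. by rewrite dotvC dotv_suml; apply: eq_bigr => i _; rewrite dotvC. Qed.

Lemma dotvv_ge0 x : 0 <= dotv x x.
Proof. by apply: sumr_ge0 => j _; rewrite -expr2 sqr_ge0. Qed.

Lemma sqr_enorm x : enorm x ^+ 2 = dotv x x.
Proof. by rewrite /enorm sqr_sqrtr // dotvv_ge0. Qed.

Lemma enorm_ge0 x : 0 <= enorm x.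
Proof. exact: sqrtr_ge0. Qed.

Definition dotvE := (dotvDl, dotvDr, dotvNl, dotvNr, dotvZl, dotvZr).

Lemma dotv_young a x y : 0 < a -> 2 * dotv x y <= a * dotv x x + a^-1 * dotv y y.
Proof.
move=> a0; have := dotvv_ge0 (a *: x - y); rewrite !dotvE (dotvC y x) => h.
rewrite -subr_ge0 -(pmulr_rge0 _ a0).
suff -> : a * (a * dotv x x + a^-1 * dotv y y - 2 * dotv x y) =
  a * (a * dotv x x) - a * dotv x y + - (a * dotv x y - dotv y y) by lra.
by field; rewrite gt_eqF.
Qed.

Lemma dotv_sub_le x y z : dotv (x - y) (x - y) <=
  2 * dotv (x - z) (x - z) + 2 * dotv (z - y) (z - y).
Proof.
have := dotvv_ge0 ((x - z) - (z - y)).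
by rewrite !dotvE (dotvC y x) (dotvC z x) (dotvC z y); lra.
Qed.

Lemma dotv_add3_le x y z : dotv (x + y + z) (x + y + z) <=
  3 * dotv x x + 3 * dotv y y + 3 * dotv z z.
Proof.
have := dotvv_ge0 (x - z); have := dotvv_ge0 (x - y); have := dotvv_ge0 (y - z).
by rewrite !dotvE (dotvC y x) (dotvC z x) (dotvC z y); lra.
Qed.

(** Weighted Cauchy-Schwarz: Young's inequality is applied to each [dotv u (v i)] with parameter
    [w i / T]; these parameters sum to at most 1, so they use up one of the two copies of
    [dotv u u]. With smoothness constants as weights, the right side has the shape that
    co-coercivity controls. *)
Lemma dotv_sum_weighted (I : finType) (P : pred I) (w : I -> R)
    (v : I -> 'rV[R]_d) (T : R) :
  0 < T -> (forall i, 0 < w i) -> \sum_(i | P i) w i <= T ->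
  dotv (\sum_(i | P i) v i) (\sum_(i | P i) v i)
    <= T * \sum_(i | P i) dotv (v i) (v i) / w i.
Proof.
move=> T0 w0 wT; set u := \sum_(i | P i) v i.
have h : 2 * dotv u u <=
    \sum_(i | P i) (w i / T * dotv u u + T * (dotv (v i) (v i) / w i)).
  have uu : dotv u u = \sum_(i | P i) dotv u (v i) by rewrite -dotv_sumr.
  rewrite {1}uu mulr_sumr; apply: ler_sum => i _.
  apply: (le_trans (dotv_young u (v i) (divr_gt0 (w0 i) T0))).
  by rewrite invf_div lerD2l -mulrA (mulrC _^-1).
rewrite big_split /= -mulr_suml -mulr_suml -mulr_sumr in h.
have : (\sum_(i | P i) w i) / T * dotv u u <= dotv u u.
  by apply: ler_piMl; [exact: dotvv_ge0|rewrite ler_pdivrMr // mul1r].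
lra.
Qed.

End InnerProduct.

(** * Smooth convex functions *)

Section SmoothConvex.
Context {R : realType} {d : nat}.
Variables (f : 'rV[R]_d -> R) (g : 'rV[R]_d -> 'rV[R]_d) (L : R).
Implicit Types (x y z h : 'rV[R]_d) (e : R).
Hypotheses (fconv : convex_fun f) (fg : has_gradient f g).

(** The limit of difference quotients is needed at a single small [t] only, kept below 1 so that
    convexity applies to it. *)
Lemma gradient_lower_bound x h e : 0 < e ->
  exists2 t : R, 0 < t < 1 & t * (dotv (g x) h - e) <= f (x + t *: h) - f x.
Proof.
move=> e0; have [df dfE] := fg x.
have dr : derivable f x h by exact: diff_derivable.
have dE : 'D_h f x = dotv (g x) h by rewrite deriveE // dfE.
have /cvgrPdist_lt/(_ _ e0) : ((fun t : R => t^-1 *: ((f \o shift x) (t *: h) - f x)) @ 0^'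
    --> dotv (g x) h)%classic by rewrite -dE; exact: dr.
move=> /nbhs_ballP[r /= r0 H].
pose t := Num.min (r / 2) 2^-1.
have t0 : 0 < t by rewrite lt_min; apply/andP; split; lra.
have t1 : t < 1 by rewrite gt_min; apply/orP; right; lra.
have tr : t < r by rewrite gt_min; apply/orP; left; lra.
exists t; first by rewrite t0.
have /H : ball (0 : R) r t by rewrite /ball /= sub0r normrN gtr0_norm.
move=> /(_ (lt0r_neq0 t0)) /=; rewrite (addrC _ x).
rewrite ltr_norml => /andP[_ h2].
rewrite mulrC -ler_pdivlMr // mulrC.
by rewrite /GRing.scale /= in h2; lra.
Qed.

Lemma convex_gradient_le x y : f x + dotv (g x) (y - x) <= f y.
Proof.
rewrite leNgt; apply/negP => lt.
(* Half of the supposed violation, so that a strict gap survives the error in the difference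
   quotient. *)
pose e := (f x + dotv (g x) (y - x) - f y) / 2.
have e0 : 0 < e by rewrite /e; lra.
have [t /andP[t0 t1] ht] := gradient_lower_bound x (y - x) e0.
have /(fconv x y) : 0 < t < 1 by rewrite t0.
have -> : (1 - t) *: x + t *: y = x + t *: (y - x).
  by rewrite scalerBl scale1r scalerBr addrAC -!addrA.
move=> hc; have : t * (dotv (g x) (y - x) - e) <= t * (f y - f x) by lra.
rewrite ler_pM2l // /e; lra.
Qed.

Hypotheses (L0 : 0 < L) (gL : lipschitz_map g L).

Lemma gradient_lipschitz_sqr x y :
  dotv (g x - g y) (g x - g y) <= L ^+ 2 * dotv (x - y) (x - y).
Proof.
rewrite -!sqr_enorm -exprMn ler_pXn2r ?nnegrE ?enorm_ge0 //.
by rewrite mulr_ge0 ?enorm_ge0 // ltW.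
Qed.

(* Convexity at [y] alone gives the descent lemma with [L] in place of [L / 2]. *)
Lemma smooth_descent x y :
  f y <= f x + dotv (g x) (y - x) + L * dotv (y - x) (y - x).
Proof.
have h1 := convex_gradient_le y x; have h2 := gradient_lipschitz_sqr y x.
have Li0 : 0 < L^-1 by rewrite invr_gt0.
have := dotv_young (g y - g x) (y - x) Li0; rewrite invrK => h3.
have h4 : L^-1 * dotv (g y - g x) (g y - g x) <= L * dotv (y - x) (y - x).
  by rewrite mulrC ler_pdivrMr // (le_trans h2) // expr2 mulrAC.
have h5 : dotv (g y) (x - y) = - dotv (g y) (y - x) by rewrite -dotvNr opprB.
by rewrite dotvDl dotvNl in h3; lra.
Qed.

(* Apply [smooth_descent] at the gradient step of length [1 / (2 L)] for
   [f - dotv (g x)], which is minimal at [x]. *)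
Lemma smooth_cocoercive x z :
  dotv (g z - g x) (g z - g x) / L <= 4 * (f z - f x - dotv (g x) (z - x)).
Proof.
set v := g z - g x.
have hv : dotv (g z) v = dotv (g x) v + dotv v v.
  by rewrite -[in RHS]dotvDl /v addrCA subrr addr0.
clearbody v; pose s := (2 * L)^-1.
have h1 := convex_gradient_le x (z - s *: v).
have h2 := smooth_descent z (z - s *: v).
have e : z - s *: v - z = - s *: v by rewrite addrAC subrr add0r scaleNr.
have e' : z - s *: v - x = (z - x) - s *: v by rewrite addrAC.
rewrite e in h2; rewrite e' in h1.
rewrite !dotvE in h2; rewrite dotvDr dotvNr dotvZr in h1.
rewrite hv in h2.
have s1 : L * (- s * (- s * dotv v v)) = s / 2 * dotv v v.
  by rewrite /s; field; rewrite gt_eqF.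
have s2 : dotv v v / L = 2 * (s * dotv v v) by rewrite /s; field; rewrite gt_eqF.
rewrite s1 in h2; rewrite s2; rewrite dotvDr dotvNr in h1 *; lra.
Qed.

End SmoothConvex.

(** * First-order optimality for extended-valued convex functions *)

Lemma linear_part_ge0 (R : realType) (A B : R) :
  (forall t, 0 < t < 1 -> 0 <= t * A + t ^+ 2 * B) -> 0 <= A.
Proof.
move=> H; rewrite leNgt; apply/negP => A0.
have B0 := normr_ge0 B; have B1 : 0 < `|B| + 1 by lra.
(* Small enough for [t * B] to be at most [- A / 2], so that [A + t * B] stays negative. *)
pose t := Num.min 2^-1 (- A / 2 / (`|B| + 1)).
have t0 : 0 < t by rewrite lt_min; apply/andP; split; [lra|rewrite divr_gt0 //; lra].
have t1 : t < 1 by rewrite gt_min; apply/orP; left; lra.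
have /H : 0 < t < 1 by rewrite t0.
have tB : t * (`|B| + 1) <= - A / 2 by rewrite -ler_pdivlMr // ge_min lexx orbT.
rewrite expr2 -mulrA -mulrDr pmulr_rge0 // => h.
have h2 : t * B <= t * (`|B| + 1).
  by rewrite ler_wpM2l ?(ltW t0) // (le_trans (ler_norm B)) // lerDl.
lra.
Qed.

Section ExtendedConvex.
Context {R : realType} {d : nat}.
Variable psi : 'rV[R]_d -> \bar R.
Hypotheses (psiP : proper_efun psi) (psiC : convex_efun psi).
Implicit Types (x y z w : 'rV[R]_d) (eta t : R).

Lemma proper_fineK x : (psi x < +oo)%E -> (fine (psi x))%:E = psi x.
Proof.
by move=> xoo; rewrite fineK // fin_numE psiP.1 lt_eqF.
Qed.

Lemma convex_fine_le x y t : (psi x < +oo)%E -> (psi y < +oo)%E -> 0 < t < 1 ->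
  (psi ((1 - t) *: x + t *: y)%R < +oo)%E /\
  fine (psi ((1 - t) *: x + t *: y)) <= (1 - t) * fine (psi x) + t * fine (psi y).
Proof.
move=> xoo yoo t01; have := psiC x y t01.
rewrite -(proper_fineK xoo) -(proper_fineK yoo) -!EFinM -EFinD => h.
have oo : (psi ((1 - t) *: x + t *: y)%R < +oo)%E by rewrite (le_lt_trans h) // ltry.
by split=> //; move: h; rewrite -(proper_fineK oo) lee_fin.
Qed.

Lemma subgrad_fine y g : (psi y < +oo)%E ->
  (forall x, (psi x < +oo)%E -> fine (psi y) + dotv g (x - y) <= fine (psi x)) ->
  subgrad psi y g.
Proof.
move=> yoo H x; have [xoo|] := ltP (psi x) +oo%E; last by rewrite leye_eq => /eqP ->; rewrite leey.
by rewrite -(proper_fineK xoo) -(proper_fineK yoo) -EFinD lee_fin H.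
Qed.

(* First-order optimality of [y] for [psi + h], where the smooth part [h] is only
   known through a quadratic upper bound at [y]. *)
Lemma minimizer_subgrad (h : 'rV[R]_d -> R) g M y : (psi y < +oo)%E ->
  (forall x, h x <= h y + dotv g (x - y) + M * dotv (x - y) (x - y)) ->
  (forall x, (psi x < +oo)%E -> fine (psi y) + h y <= fine (psi x) + h x) ->
  subgrad psi y (- g).
Proof.
move=> yoo hM ymin; apply: subgrad_fine => // x xoo.
suff : 0 <= fine (psi x) - fine (psi y) + dotv g (x - y) by rewrite dotvNl; lra.
apply: (@linear_part_ge0 _ _ (M * dotv (x - y) (x - y))) => t t01.
have [zoo zle] := convex_fine_le yoo xoo t01; set z := _ + _ in zoo zle.
have zy : z - y = t *: (x - y).
  by apply/rowP => j; rewrite !mxE; ring.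
have := hM z; have := ymin z zoo; rewrite zy !dotvE; lra.
Qed.

(** If [psi z] were infinite, so would be the prox objective at [z], since [n > 0]; but it lies
    below the finite value at [w]. *)
Lemma prox_point_fin n eta y z w : (0 < n)%N -> is_prox_point n psi eta y z ->
  (psi w < +oo)%E -> (psi z < +oo)%E.
Proof.
move=> n0 H woo; rewrite ltey; apply/eqP => zoo; have := H w.
rewrite zoo gt0_muley ?lte_fin ?ltr0n // addye ?ltNyr //.
by rewrite -(proper_fineK woo) -EFinM -EFinD leNgt ltry.
Qed.

(** After division by [n] the prox objective is [psi] plus a quadratic, for which the upper bound
    required by [minimizer_subgrad] is an equality. *)
Lemma prox_point_subgrad n eta y z : (0 < n)%N -> 0 < eta -> (psi z < +oo)%E ->
  is_prox_point n psi eta y z -> subgrad psi z ((n%:R * eta)^-1 *: (y - z)).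
Proof.
move=> n0 eta0 zoo H; have n0' : (0 : R) < n%:R by rewrite ltr0n.
have ne0 : 0 < n%:R * eta by rewrite mulr_gt0.
rewrite -(opprB z y) scalerN.
apply: (@minimizer_subgrad (fun x => dotv (x - y) (x - y) / (2 * (n%:R * eta))) _
         (2 * (n%:R * eta))^-1) => // x.
  have -> : x - y = (x - z) + (z - y) by rewrite addrA subrK.
  rewrite le_eqVlt; apply/orP; left; apply/eqP.
  move: (x - z) (z - y) => u v; rewrite !dotvE (dotvC u v).
  by field; rewrite !gt_eqF.
move=> xoo; have := H x; rewrite -(proper_fineK zoo) -(proper_fineK xoo) -!EFinM -!EFinD.
have nV : 0 < n%:R^-1 :> R by rewrite invr_gt0.
rewrite lee_fin !sqr_enorm -(ler_pM2l nV).
rewrite !mulrDr !mulKf ?gt_eqF //.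
by rewrite !(mulrC n%:R^-1) -!mulrA -!invfM (mulrC _ n%:R) (mulrCA n%:R).
Qed.

Lemma mu_subgrad_fine mu y g x : mu_psi_condition psi mu -> subgrad psi y g ->
  (psi y < +oo)%E -> (psi x < +oo)%E ->
  fine (psi y) + dotv g (x - y) + mu / 2 * dotv (x - y) (x - y) <= fine (psi x).
Proof.
move=> [_ /(_ x y g)] H /H {}H yoo xoo; move: H.
by rewrite -(proper_fineK yoo) -(proper_fineK xoo) -EFinD lee_fin sqr_enorm addrA.
Qed.

End ExtendedConvex.

(** * Prefix sums of gradients along a permutation *)

Section Shuffling.
Context {R : realType} {d n : nat}.
Variables (L : 'I_n -> R) (g : 'I_n -> 'rV[R]_d).
Hypothesis L0 : forall i, 0 <= L i.
Local Notation G2 := (dotv (\sum_i g i) (\sum_i g i)).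
Local Notation S2 := (\sum_i dotv (g i) (g i)).

Let S2_ge0 : 0 <= S2.
Proof. by apply: sumr_ge0 => i _; exact: dotvv_ge0. Qed.

Lemma sum_perm (V : nmodType) (h : 'I_n -> V) (s : {perm 'I_n}) :
  \sum_i h (s i) = \sum_i h i.
Proof. by rewrite [RHS](reindex_inj (@perm_inj _ s)). Qed.

(* By exchangeability the sum over [s] of [L (s i) * <g (s j), g (s k)>] takes
   only two values on [j, k != i], according to whether [j = k]; so the square
   over [j < i] is bounded by the ones over all [j != i]. *)
Lemma sum_perm_prefix_le (i : 'I_n) :
  \sum_(s : {perm 'I_n}) L (s i) *
    dotv (\sum_(j < n | (j < i)%N) g (s j)) (\sum_(j < n | (j < i)%N) g (s j))
  <= \sum_(s : {perm 'I_n}) L (s i) * (2 * G2 + 2 * S2).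
Proof.
pose T j k := \sum_(s : {perm 'I_n}) L (s i) * dotv (g (s j)) (g (s k)).
have TC j k : T j k = T k j by apply: eq_bigr => s _; rewrite dotvC.
(* Translating the sum over [s] by [p^-1] relabels the positions; as [p] fixes [i], the factor
   [L (s i)] is unaffected. *)
have Tp (p : {perm 'I_n}) j k : p i = i -> T (p j) (p k) = T j k.
  move=> pi; rewrite /T (reindex_inj (mulgI p^-1%g)) /=; apply: eq_bigr => s _.
  by rewrite !permM !permK -{1}pi permK.
have Tl j j' k : j != i -> j' != i -> j != k -> j' != k -> T j k = T j' k.
  move=> ji j'i jk j'k; rewrite -(Tp (tperm j j') j k).
    by rewrite tpermL tpermD.
  by rewrite tpermD.
have Tr j k k' : k != i -> k' != i -> k != j -> k' != j -> T j k = T j k'.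
  by move=> *; rewrite !(TC j); apply: Tl.
(* [B] is the diagonal value and [A], below, the off-diagonal one. When [n] is too small for such
   indices to exist, 0 serves. *)
have [B HB] : exists B, forall j, j != i -> T j j = B.
  have [[j0 hj0]|no] := pselect (exists j0, j0 != i).
    exists (T j0 j0) => j ji; rewrite -(Tp (tperm j j0) j j) ?tpermL //.
    by rewrite tpermD.
  by exists 0 => j ji; case: no; exists j.
have [A HA] : exists A, forall j k, j != i -> k != i -> j != k -> T j k = A.
  have [[[j0 k0] [/= hj hk hjk]]|no] := pselect (exists jk : 'I_n * 'I_n,
      [/\ jk.1 != i, jk.2 != i & jk.1 != jk.2]); last first.
    by exists 0 => j k ji ki jk; case: no; exists (j, k).
  exists (T j0 k0) => j k ji ki jk.
  have [e|ne] := eqVneq j0 k; last by rewrite (@Tl j j0 k) // (@Tr j0 k k0) // eq_sym.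
  by rewrite TC -e (@Tr j0 j k0) // 1?eq_sym // e eq_sym.
have sumT (P : pred 'I_n) : (forall j, P j -> j != i) ->
    \sum_(s : {perm 'I_n}) L (s i) * dotv (\sum_(j | P j) g (s j)) (\sum_(j | P j) g (s j))
    = (#|P|%:R * B + (#|P| * #|P|.-1)%:R * A).
  move=> Pi.
  transitivity (\sum_(j | P j) \sum_(k | P k) T j k).
    under eq_bigr => s _ do rewrite dotv_suml mulr_sumr.
    rewrite exchange_big /=; apply: eq_bigr => j _.
    under eq_bigr => s _ do rewrite dotv_sumr mulr_sumr.
    by rewrite exchange_big.
  transitivity (\sum_(j | P j) (B + #|P|.-1%:R * A)).
    apply: eq_bigr => j Pj; rewrite (bigD1 j) //= HB ?Pi //; congr (_ + _).
    rewrite (eq_bigr (fun=> A)) => [|k /andP[Pk kj]]; last by rewrite HA ?Pi // eq_sym.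
    rewrite sumr_const -[LHS]mulr_natl; congr (_%:R * _).
    by rewrite (cardD1x Pj) /=; apply: eq_card => k; rewrite !inE andbC.
  by rewrite sumr_const -[LHS]mulr_natl mulrDr natrM mulrA.
set Gam := \sum_(s : {perm 'I_n}) L (s i) * (2 * G2 + 2 * S2).
have sumD (V : nmodType) (h : 'I_n -> V) (s : {perm 'I_n}) :
    h (s i) + \sum_(j | j != i) h (s j) = \sum_j h j.
  by rewrite -(sum_perm h s) [RHS](bigD1 i).
have G0 : 0 <= G2 by exact: dotvv_ge0.
have NB : #|predC1 i|%:R * B <= Gam.
  have -> : #|predC1 i|%:R * B = \sum_(j | j != i) T j j.
    rewrite (eq_bigr (fun=> B)) => [|j ji]; last exact: HB.
    by rewrite sumr_const mulr_natl.
  rewrite /T exchange_big /=; apply: ler_sum => s _; rewrite -mulr_sumr.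
  apply: ler_wpM2l => //; have := sumD _ (fun j => dotv (g j) (g j)) s.
  have := dotvv_ge0 (g (s i)) => /=; have := S2_ge0; lra.
(* Over all indices other than [i] the sum is the total minus [g (s i)]; its square costs [2 * G2]
   plus twice the square of [g (s i)], which is part of [S2]. *)
have NA : #|predC1 i|%:R * B + (#|predC1 i| * #|predC1 i|.-1)%:R * A <= Gam.
  rewrite -(sumT (predC1 i)) //; apply: ler_sum => s _; apply: ler_wpM2l => //=.
  have := sumD _ g s => /= /(canRL (addKr _)); rewrite addrC => ->.
  have := dotv_sub_le (\sum_j g j) (g (s i)) 0; rewrite !subr0 sub0r dotvNl dotvNr opprK => h.
  have h2 : 0 <= \sum_(j | j != i) dotv (g (s j)) (g (s j)).
    by apply: sumr_ge0 => j _; exact: dotvv_ge0.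
  have := sumD _ (fun j => dotv (g j) (g j)) s => /=; lra.
have B0 j : j != i -> 0 <= B.
  by move=> ji; rewrite -(HB j ji) sumr_ge0 // => s _; rewrite mulr_ge0 ?dotvv_ge0.
rewrite (sumT (fun j : 'I_n => (j < i)%N)); last first.
  by move=> j ji; apply: contraTneq ji => ->; rewrite ltnn.
set m := #|_|; set N := #|predC1 i| in NB NA.
have mN : (m <= N)%N.
  apply/subset_leq_card/fintype.subsetP => j ji; rewrite !inE.
  by apply: contraTneq (ji : (j < i)%N) => ->; rewrite ltnn.
have [N0|Npos] := posnP N.
  by move: mN NB NA; rewrite N0 leqn0 => /eqP ->.
have {}B0 : 0 <= B.
  by move/card_gt0P : Npos => [j]; rewrite inE => ji; apply: B0 ji.
(* For [A <= 0] the off-diagonal part is dropped and [NB] suffices; for [A > 0] both parts grow with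
   the number of indices, so [NA] does. *)
have [A0|A0] := leP A 0.
  have h1 : (m * m.-1)%:R * A <= 0 by rewrite mulr_ge0_le0.
  have h2 : m%:R * B <= N%:R * B by rewrite ler_wpM2r // ler_nat.
  lra.
have h1 : (m * m.-1)%:R * A <= (N * N.-1)%:R * A.
  by rewrite ler_wpM2r ?(ltW A0) // ler_nat leq_mul // -!subn1 leq_sub2r.
have h2 : m%:R * B <= N%:R * B by rewrite ler_wpM2r // ler_nat.
lra.
Qed.

(* The part of the epoch error that only depends on the minimizer, with
   [g i] standing for the gradient of the [i]-th component there. *)
Definition shuffle_residual (eta : R) (s : {perm 'I_n}) : R :=
  6 * eta ^+ 2 / n%:R * \sum_(i < n) L (s i) *
    dotv (\sum_(j < n | (j < i)%N) g (s j)) (\sum_(j < n | (j < i)%N) g (s j)).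

Lemma shuffle_residual_ge0 eta s : 0 <= shuffle_residual eta s.
Proof.
apply: mulr_ge0; first by rewrite divr_ge0 // mulr_ge0 // sqr_ge0.
by apply: sumr_ge0 => i _; rewrite mulr_ge0 ?dotvv_ge0.
Qed.

(** A prefix has at most [n] terms, so Cauchy-Schwarz with unit weights costs a factor [n], whatever
    the permutation. *)
Lemma shuffle_residual_le eta s : (0 < n)%N ->
  shuffle_residual eta s <= 6 * eta ^+ 2 * (\sum_i L i) * S2.
Proof.
move=> n0; have n0' : (0 : R) < n%:R by rewrite ltr0n.
have -> : 6 * eta ^+ 2 * (\sum_i L i) * S2 =
    6 * eta ^+ 2 / n%:R * \sum_i L (s i) * (n%:R * S2).
  by rewrite -mulr_suml (sum_perm L); field; rewrite gt_eqF.
apply: ler_wpM2l; first by rewrite divr_ge0 // mulr_ge0 // sqr_ge0.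
apply: ler_sum => i _; apply: ler_wpM2l => //.
apply: le_trans (dotv_sum_weighted _ n0' (fun=> ltr01) _) _.
  rewrite sumr_const ler_nat -[leqRHS]card_ord; exact: max_card.
apply: ler_wpM2l; first exact: ltW.
rewrite -(sum_perm (fun j => dotv (g j) (g j)) s) big_mkcond /=.
by apply: ler_sum => j _; case: ifP => _; rewrite ?divr1 ?dotvv_ge0.
Qed.

(** Compared with the worst case, averaging replaces [S2] by [2 (G2 + S2) / n], the source of the
    better bound for random permutations. *)
Lemma shuffle_residual_mean_le eta : (0 < n)%N ->
  (n`!)%:R^-1 * \sum_(s : {perm 'I_n}) shuffle_residual eta s
  <= 12 * eta ^+ 2 / n%:R * (\sum_i L i) * (G2 + S2).
Proof.
move=> n0; have n0' : (0 : R) < n%:R by rewrite ltr0n.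
have f0 : (0 : R) < (n`!)%:R by rewrite ltr0n fact_gt0.
rewrite mulrC ler_pdivrMr // -mulr_sumr exchange_big /=.
have h : \sum_(i < n) \sum_(s : {perm 'I_n}) L (s i) * (2 * G2 + 2 * S2)
    = (n`!)%:R * ((\sum_i L i) * (2 * G2 + 2 * S2)).
  rewrite exchange_big /= (eq_bigr (fun=> (\sum_i L i) * (2 * G2 + 2 * S2))).
    by rewrite sumr_const -[LHS]mulr_natl card_Sn.
  by move=> s _; rewrite -mulr_suml (sum_perm L).
apply: (@le_trans _ _ (6 * eta ^+ 2 / n%:R *
    \sum_(i < n) \sum_(s : {perm 'I_n}) L (s i) * (2 * G2 + 2 * S2))).
  apply: ler_wpM2l; first by rewrite divr_ge0 // mulr_ge0 // sqr_ge0.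
  by apply: ler_sum => i _; exact: sum_perm_prefix_le.
rewrite h le_eqVlt; apply/orP; left; apply/eqP.
set g2 := G2; set s2 := S2; set l := \sum_i L i.
by field; rewrite gt_eqF.
Qed.

End Shuffling.

(** * Inner iterates and the progress of one epoch *)

Lemma epoch_pass_iterates (R : realType) (d n : nat) (gr : 'I_n -> 'rV[R]_d -> 'rV[R]_d)
    (eta : R) (s : {perm 'I_n}) (x : 'rV[R]_d) :
  exists2 Y : nat -> 'rV[R]_d, Y n = epoch_pass gr eta s x &
  forall m, (m <= n)%N -> Y m = x - eta *: \sum_(j < n | (j < m)%N) gr (s j) (Y j).
Proof.
pose step y i := y - eta *: gr (s i) y.
pose Y m := foldl step x (take m (enum 'I_n)).
exists Y; first by rewrite /Y take_oversize // size_enum_ord.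
elim=> [|m IH] mn; first by rewrite big_pred0 // scaler0 subr0 /Y take0.
have YS : Y m.+1 = step (Y m) (Ordinal mn).
  rewrite /Y (take_nth (Ordinal mn)) ?size_enum_ord // -cats1 foldl_cat /=.
  by congr step; apply: val_inj; rewrite /= nth_enum_ord.
rewrite YS /step {1}IH ?(ltnW mn) // [in RHS](bigD1 (Ordinal mn)) //=.
rewrite scalerDr opprD [RHS]addrA [RHS]addrAC.
congr (_ - _ *: _ - _); apply: eq_bigl => j.
by rewrite ltnS ltn_neqAle -val_eqE andbC.
Qed.

Section Epoch.
Context {R : realType} {d n : nat}.
Variables (f : 'I_n -> 'rV[R]_d -> R) (gr : 'I_n -> 'rV[R]_d -> 'rV[R]_d).
Variables (L : 'I_n -> R) (psi : 'rV[R]_d -> \bar R) (mu_psi eta : R).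
Variables (xstar : 'rV[R]_d).
Implicit Types (x y z xp : 'rV[R]_d) (s : {perm 'I_n}).
Hypotheses (n0 : (0 < n)%N) (fC : forall i, convex_fun (f i)).
Hypotheses (fG : forall i, has_gradient (f i) (gr i)) (L0 : forall i, 0 < L i).
Hypotheses (gL : forall i, lipschitz_map (gr i) (L i)).
Hypotheses (psiP : proper_efun psi) (psiC : convex_efun psi).
Hypotheses (psiM : mu_psi_condition psi mu_psi) (xoo : (psi xstar < +oo)%E).
Hypothesis xmin : forall x, ((n%:R^-1 * \sum_i f i xstar)%:E + psi xstar
              <= (n%:R^-1 * \sum_i f i x)%:E + psi x)%E.
Hypotheses (eta0 : 0 < eta) (etaL : 4 * eta * \sum_i L i <= 1).
Hypothesis etaL2 : 24 * eta ^+ 2 * (\sum_i L i) ^+ 2 <= 1.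

Definition mean_fun x := n%:R^-1 * \sum_i f i x.
Definition mean_grad x := n%:R^-1 *: \sum_i gr i x.
Definition objective x := mean_fun x + fine (psi x).

Let W := \sum_i L i.
Let nR0 : (0 : R) < n%:R. Proof. by rewrite ltr0n. Qed.
Let W0 : 0 < W.
Proof.
rewrite /W (bigD1 (Ordinal n0)) //= ltr_pwDl //.
by rewrite sumr_ge0 // => i _; rewrite ltW.
Qed.

Lemma sum_bregman x y : \sum_i (f i x - f i y - dotv (gr i y) (x - y))
  = n%:R * (mean_fun x - mean_fun y - dotv (mean_grad y) (x - y)).
Proof.
rewrite /mean_fun /mean_grad dotvZl !mulrBr !mulVKf ?gt_eqF // dotv_suml.
by rewrite !sumrB.
Qed.

Lemma mean_descent x y : mean_fun y - mean_fun x - dotv (mean_grad x) (y - x)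
  <= n%:R^-1 * W * dotv (y - x) (y - x).
Proof.
rewrite -(ler_pM2l nR0) -sum_bregman !mulrA divff ?gt_eqF // mul1r mulr_suml.
apply: ler_sum => i _; have := smooth_descent (fC i) (fG i) (L0 i) (gL i) x y; lra.
Qed.

Lemma minimizer_subgrad_mean : subgrad psi xstar (- mean_grad xstar).
Proof.
apply: (@minimizer_subgrad _ _ _ psiP psiC mean_fun _ (n%:R^-1 * W)) => // x.
  have := mean_descent xstar x; lra.
move=> xoo'; have := xmin x; rewrite -(proper_fineK psiP xoo) -(proper_fineK psiP xoo').
by rewrite -!EFinD lee_fin -!/(mean_fun _) /=; lra.
Qed.

(** The [mu_psi] condition is used at [xstar] with the subgradient [- mean_grad xstar], which
    supplies the linear term of the Bregman distance of the mean function. *)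
Lemma objective_growth x : (psi x < +oo)%E ->
  mean_fun x - mean_fun xstar - dotv (mean_grad xstar) (x - xstar)
    + mu_psi / 2 * dotv (x - xstar) (x - xstar) <= objective x - objective xstar.
Proof.
move=> xoo'; have := mu_subgrad_fine psiP psiM minimizer_subgrad_mean xoo xoo'.
rewrite /objective dotvNl; lra.
Qed.

(** Bregman terms based at the inner iterates turn the difference of mean values into the sum of
    [Bx] minus that of [Bz], plus a linear term. Smoothness bounds [Bx] through the drift [x - Y i],
    co-coercivity bounds the drift by [Bz], [Bs] and the residual, and the negative [Bz] absorbs its
    own share. Optimality of the prox point turns the linear terms into squared distances. *)
Lemma epoch_progress s x xp z : (psi z < +oo)%E -> (psi xp < +oo)%E ->
  is_prox_point n psi eta (epoch_pass gr eta s x) xp ->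
  2 * n%:R * eta * (objective xp - objective z) <=
  dotv (z - x) (z - x) - (1 + n%:R * eta * mu_psi) * dotv (z - xp) (z - xp)
  + 2 * n%:R * eta * (24 * eta ^+ 2 * W ^+ 2 * (objective z - objective xstar)
                      + shuffle_residual L (fun i => gr i xstar) eta s).
Proof.
move=> zoo xpoo prox; have [Y Yn YE] := epoch_pass_iterates gr eta s x.
rewrite -Yn in prox.
pose v (i : 'I_n) := gr (s i) (Y i).
pose Bx (i : 'I_n) := f (s i) xp - f (s i) (Y i) - dotv (v i) (xp - Y i).
pose Bz (i : 'I_n) := f (s i) z - f (s i) (Y i) - dotv (v i) (z - Y i).
pose Bs i := f i z - f i xstar - dotv (gr i xstar) (z - xstar).
pose rho (i : 'I_n) := dotv (\sum_(j < n | (j < i)%N) gr (s j) xstar)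
                   (\sum_(j < n | (j < i)%N) gr (s j) xstar).
have Bz0 i : 0 <= Bz i.
  have := convex_gradient_le (fC (s i)) (fG (s i)) (Y i) z; rewrite /Bz /v; lra.
have Bs0 i : 0 <= Bs i.
  have := convex_gradient_le (fC i) (fG i) xstar z; rewrite /Bs; lra.
have WP (P : pred 'I_n) : \sum_(j | P j) L (s j) <= W.
  rewrite /W -(sum_perm L s) big_mkcond /=; apply: ler_sum => j _.
  by case: ifP => // _; rewrite ltW.
have drift (i : 'I_n) : dotv (x - Y i) (x - Y i) <= 3 * eta ^+ 2 *
    (4 * W * (\sum_j Bz j) + 4 * W * (\sum_j Bs j) + rho i).
  rewrite (YE _ (ltnW (ltn_ord i))) opprB addrCA subrr addr0 dotvZl dotvZr mulrA -expr2.
  rewrite (mulrC 3) -[leRHS]mulrA; apply: ler_wpM2l; first exact: sqr_ge0.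
  (* Passing through [z] and then [xstar] makes each difference of gradients controllable by a
     Bregman term; only the gradients at [xstar] are left to the residual. *)
  have -> : \sum_(j < n | (j < i)%N) gr (s j) (Y j) =
      \sum_(j < n | (j < i)%N) (v j - gr (s j) z)
      + \sum_(j < n | (j < i)%N) (gr (s j) z - gr (s j) xstar)
      + \sum_(j < n | (j < i)%N) gr (s j) xstar.
    rewrite -!big_split /=; apply: eq_bigr => j _.
    by rewrite addrA !subrK.
  apply: (le_trans (dotv_add3_le _ _ _)); rewrite -/(rho i).
  have h1 := dotv_sum_weighted (fun j => v j - gr (s j) z) W0 (fun j => L0 (s j))
    (WP (fun j => (j < i)%N)).
  have h2 := dotv_sum_weighted (fun j => gr (s j) z - gr (s j) xstar) W0 (fun j => L0 (s j))
    (WP (fun j => (j < i)%N)).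
  have {}h1 : dotv (\sum_(j < n | (j < i)%N) (v j - gr (s j) z))
      (\sum_(j < n | (j < i)%N) (v j - gr (s j) z)) <= 4 * W * \sum_j Bz j.
    apply: (le_trans h1); rewrite (mulrC 4) -mulrA; apply: ler_wpM2l; first exact: ltW.
    rewrite mulr_sumr big_mkcond /=; apply: ler_sum => j _.
    case: ifP => _; last by rewrite mulr_ge0.
    rewrite -opprB dotvNl dotvNr opprK.
    exact: (smooth_cocoercive (fC _) (fG _) (L0 _) (gL _)).
  have {}h2 : dotv (\sum_(j < n | (j < i)%N) (gr (s j) z - gr (s j) xstar))
      (\sum_(j < n | (j < i)%N) (gr (s j) z - gr (s j) xstar)) <= 4 * W * \sum_j Bs j.
    apply: (le_trans h2); rewrite (mulrC 4) -mulrA; apply: ler_wpM2l; first exact: ltW.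
    rewrite -(sum_perm Bs s) mulr_sumr big_mkcond /=; apply: ler_sum => j _.
    case: ifP => _; last by rewrite mulr_ge0.
    exact: (smooth_cocoercive (fC _) (fG _) (L0 _) (gL _)).
  lra.
set a := 24 * eta ^+ 2 * W ^+ 2.
set r := shuffle_residual _ _ _ _.
(* The 24 in [a] is [2 * 3 * 4]: splitting [xp - Y i] at [x], the three parts of the drift, and
   co-coercivity. Summing [L (s i)] gives the second factor [W]. *)
have sumBx : \sum_i Bx i <= 2 * W * dotv (xp - x) (xp - x)
    + a * (\sum_i Bz i + \sum_i Bs i) + n%:R * r.
  have -> : 2 * W * dotv (xp - x) (xp - x) + a * (\sum_i Bz i + \sum_i Bs i) + n%:R * r
    = \sum_i L (s i) * (2 * dotv (xp - x) (xp - x) + 2 * (3 * eta ^+ 2 *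
       (4 * W * (\sum_j Bz j) + 4 * W * (\sum_j Bs j) + rho i))).
    have -> : n%:R * r = 6 * eta ^+ 2 * \sum_i L (s i) * rho i.
      by rewrite /r /shuffle_residual mulrA; congr (_ * _); field; rewrite gt_eqF.
    rewrite /a; set X := dotv (xp - x) (xp - x); set SZ := \sum_i Bz i; set SS := \sum_i Bs i.
    rewrite [RHS](eq_bigr (fun i => L (s i) * (2 * X + 24 * eta ^+ 2 * W * (SZ + SS))
      + 6 * eta ^+ 2 * (L (s i) * rho i))); last by move=> i _; ring.
    rewrite [RHS]big_split /= -mulr_suml -[in RHS]mulr_sumr (sum_perm L) -/W.
    ring.
  apply: ler_sum => i _.
  have h := smooth_descent (fC (s i)) (fG (s i)) (L0 (s i)) (gL (s i)) (Y i) xp.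
  apply: (@le_trans _ _ (L (s i) * dotv (xp - Y i) (xp - Y i))).
    by rewrite /Bx /v; lra.
  apply: ler_wpM2l; first exact: ltW.
  by apply: (le_trans (dotv_sub_le _ _ x)); rewrite lerD2l ler_pM2l.
have sumBs : \sum_i Bs i <= n%:R * (objective z - objective xstar).
  rewrite sum_bregman ler_pM2l //; apply: le_trans (objective_growth zoo).
  by rewrite lerDl mulr_ge0 ?dotvv_ge0 // divr_ge0 // psiM.1.
have sumv : eta *: \sum_i v i = x - Y n.
  rewrite YE // opprB addrCA subrr addr0; congr (_ *: _); apply: eq_bigl => j.
  by rewrite ltn_ord.
have sumf : n%:R * (mean_fun xp - mean_fun z) =
    \sum_i Bx i - \sum_i Bz i + dotv (\sum_i v i) (xp - z).
  rewrite dotv_suml -sumrB -big_split /= /mean_fun mulrBr !mulVKf ?gt_eqF //.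
  rewrite -(sum_perm (f^~ xp) s) -(sum_perm (f^~ z) s) -sumrB; apply: eq_bigr => i _.
  by rewrite /Bx /Bz !dotvE; ring.
have sg := prox_point_subgrad psiP psiC n0 eta0 xpoo prox.
have hpsi := mu_subgrad_fine psiP psiM sg xpoo zoo.
have aZ : a * \sum_i Bz i <= \sum_i Bz i.
  by apply: ler_piMl; [apply: sumr_ge0 => i _|exact: etaL2].
have aS : a * \sum_i Bs i <= a * (n%:R * (objective z - objective xstar)).
  by apply: ler_wpM2l => //; rewrite mulr_ge0 ?sqr_ge0 // mulr_ge0 ?sqr_ge0.
(* Lets the negative square of [xp - x] in [polar] absorb the smoothness error. *)
have hX : 4 * eta * W * dotv (xp - x) (xp - x) <= dotv (xp - x) (xp - x).
  by apply: ler_piMl; [exact: dotvv_ge0|exact: etaL].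
have e1 : eta * dotv (\sum_i v i) (xp - z) = dotv (x - Y n) (xp - z).
  by rewrite -dotvZl sumv.
have hf : n%:R * eta * (mean_fun xp - mean_fun z) <=
    2 * eta * W * dotv (xp - x) (xp - x) + n%:R * eta * (a * (objective z - objective xstar) + r)
    + dotv (x - Y n) (xp - z).
  rewrite -e1 mulrAC sumf.
  apply: (@le_trans _ _ ((2 * W * dotv (xp - x) (xp - x)
     + a * (n%:R * (objective z - objective xstar)) + n%:R * r
     + dotv (\sum_i v i) (xp - z)) * eta)).
    by apply: ler_wpM2r; [exact: ltW|lra].
  by rewrite le_eqVlt; apply/orP; left; apply/eqP; ring.
have hp : n%:R * eta * (fine (psi xp) - fine (psi z)) <=
    - dotv (Y n - xp) (z - xp) - n%:R * eta * mu_psi / 2 * dotv (z - xp) (z - xp).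
  have ne0 : 0 < n%:R * eta by rewrite mulr_gt0.
  apply: (@le_trans _ _ (n%:R * eta * (- dotv ((n%:R * eta)^-1 *: (Y n - xp)) (z - xp)
    - mu_psi / 2 * dotv (z - xp) (z - xp)))).
    by rewrite ler_pM2l //; lra.
  rewrite dotvZl le_eqVlt; apply/orP; left; apply/eqP; field.
  by rewrite !gt_eqF.
have polar : 2 * dotv (x - Y n) (xp - z) - 2 * dotv (Y n - xp) (z - xp) =
    dotv (z - x) (z - x) - dotv (z - xp) (z - xp) - dotv (xp - x) (xp - x).
  rewrite !dotvE (dotvC z x) (dotvC z xp) (dotvC xp x); ring.
rewrite /objective in hf *; lra.
Qed.

End Epoch.

(** * Real sequences: harmonic sums, suffix averages and contraction *)

Section Sequences.
Context {R : realType}.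
Implicit Types (a t b : R) (e q r D : nat -> R) (k m K : nat).

Lemma harmonic_le_ln m : (0 < m)%N ->
  \sum_(i < m) i.+1%:R^-1 <= 1 + ln (m%:R : R).
Proof.
case: m => // m _; elim: m => [|m IH]; first by rewrite big_ord1 ln1 invr1 addr0.
rewrite big_ord_recr /=.
suff : (m.+2%:R : R)^-1 <= ln m.+2%:R - ln m.+1%:R.
  rewrite lerBrDl => h; apply: le_trans (lerD IH (lexx _)) _.
  by rewrite -addrA lerD2l.
have m1 : (0 : R) < m.+1%:R by rewrite ltr0n.
have m2 : (0 : R) < m.+2%:R by rewrite ltr0n.
have h : (m.+2%:R : R)^-1 = 1 - m.+1%:R / m.+2%:R.
  rewrite -[m.+2%:R]natr1; move: (m.+1%:R : R) m1 => y y0.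
  by field; rewrite gt_eqF // ltr_wpDr.
(* [ln (1 + u) <= u] is taken at [u = (m + 1) / (m + 2) - 1], minus the new harmonic term. *)
have /le_ln1Dx : -1 < m.+1%:R / m.+2%:R - 1 :> R.
  by rewrite ltrBrDl subrr divr_gt0.
rewrite addrCA subrr addr0 lnM ?posrE ?invr_gt0 // lnV ?posrE //; move=> h'; rewrite h.
move: h'; set A := ln _; set B := ln _; set y := _ / _; lra.
Qed.

Lemma prod1D_le_expR a m : 0 <= a ->
  \prod_(i < m) (1 + a / i.+2%:R) <= expR (a * \sum_(i < m) i.+2%:R^-1).
Proof.
move=> a0; rewrite mulr_sumr expR_sum; apply: ler_prod => i _.
by rewrite expR_ge1Dx addr_ge0 // divr_ge0.
Qed.

(* [e] lists the optimality gaps backwards in time, so [e 0] is the gap of the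
   last iterate and the hypothesis compares the average of the last [k] gaps
   with the gap just before them; the induction runs over these suffix averages. *)
Lemma suffix_average_bound a e q M : 0 <= a ->
  (forall i, (i <= M)%N -> 0 <= e i) -> (forall i, (i < M)%N -> 0 <= q i) ->
  (forall k, (0 < k < M)%N ->
     \sum_(i < k) e i <= (1 + a) * k%:R * e k + \sum_(i < k) q i) ->
  forall m, (m < M)%N ->
  e 0 <= \prod_(i < m) (1 + a / i.+2%:R) *
    ((\sum_(i < m.+1) e i) / m.+1%:R + \sum_(i < m.+1) q i / i.+1%:R
      - (\sum_(i < m.+1) q i) / m.+1%:R).
Proof.
move=> a0 e0 q0 H; elim=> [|m IH] mM.
  by rewrite big_ord0 !big_ord1 /= !divr1 mul1r; lra.
apply: (le_trans (IH (ltnW mM))); rewrite [in leRHS]big_ord_recr -mulrA /=.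
apply: ler_wpM2l.
  by apply: prodr_ge0 => i _; rewrite addr_ge0 // divr_ge0.
have := H m.+1; rewrite mM => /(_ isT).
rewrite [\sum_(i < m.+2) e i]big_ord_recr [\sum_(i < m.+2) q i]big_ord_recr.
rewrite [\sum_(i < m.+2) q i / _]big_ord_recr /=.
have em := e0 m.+1 (ltnW mM); have qm := q0 m.+1 mM.
have U0 : 0 <= \sum_(i < m.+1) e i.
  by apply: sumr_ge0 => i _; apply: e0; rewrite (leq_trans (ltnW (ltn_ord i))) // ltnW.
have Q0 : 0 <= \sum_(i < m.+1) q i.
  by apply: sumr_ge0 => i _; apply: q0; rewrite (leq_trans (ltn_ord i)) // ltnW.
have SQ : (\sum_(i < m.+1) q i) / m.+2%:R <= \sum_(i < m.+1) q i / i.+1%:R.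
  rewrite mulr_suml; apply: ler_sum => i _; apply: ler_wpM2l.
    by apply: q0; rewrite (leq_trans (ltn_ord i)) // ltnW.
  by rewrite lef_pV2 ?posrE ?ltr0n // ler_nat (leq_trans (ltn_ord i)).
move: U0 Q0 SQ em qm.
move: (\sum_(i < m.+1) e i) (\sum_(i < m.+1) q i) (\sum_(i < m.+1) q i / _) => U Q S.
move: (e m.+1) (q m.+1) => x y U0 Q0 SQ x0 y0 h.
have k0 : (0 : R) < m.+1%:R by rewrite ltr0n.
rewrite -[m.+2%:R]natr1 in SQ *.
move: (m.+1%:R : R) k0 SQ h => k k0 SQ h.
have k1 : 0 < k + 1 by lra.
have -> : (U + x) / (k + 1) + (S + y / (k + 1)) - (Q + y) / (k + 1) =
  (U + x) / (k + 1) + (S - Q / (k + 1)) by field; rewrite gt_eqF.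
(* The new factor, at least 1, is needed on the average of the gaps only; on the residual part,
   nonnegative by [SQ], it is dropped. *)
rewrite mulrDr; apply: (@le_trans _ _
  ((1 + a / (k + 1)) * ((U + x) / (k + 1)) + (S - Q / (k + 1)))); last first.
  rewrite lerD2l; apply: ler_peMl; first by lra.
  by rewrite lerDl divr_ge0 // ltW.
rewrite -subr_ge0.
have -> : (1 + a / (k + 1)) * ((U + x) / (k + 1)) + (S - Q / (k + 1)) - (U / k + S - Q / k)
  = ((k * (k + 1 + a) * (U + x)) + Q * (k + 1) - U * (k + 1) ^+ 2) / (k * (k + 1) ^+ 2).
  by field; rewrite !gt_eqF.
apply: divr_ge0; last by apply: ltW; rewrite mulr_gt0 // exprn_gt0.
(* Multiplied by this positive quantity, the numerator becomes [(k + 1) ^+ 2] times the slack in [h]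
   plus nonnegative terms. *)
have k2 : 0 < 1 + k + a * k by have := mulr_ge0 a0 (ltW k0); lra.
rewrite -(pmulr_lge0 _ k2).
have -> : (k * (k + 1 + a) * (U + x) + Q * (k + 1) - U * (k + 1) ^+ 2) * (1 + k + a * k)
  = (k + 1) ^+ 2 * ((1 + a) * k * x + Q - U) + a ^+ 2 * k ^+ 2 * (U + x)
    + Q * (k + 1) * (a * k) by ring.
by rewrite !addr_ge0 ?mulr_ge0 ?exprn_ge0 ?subr_ge0 ?addr_ge0 // ltW.
Qed.

(** The product is at most [expR (a * (1 + ln M))], hence at most [expR 1], and the average of [q]
    subtracted in [suffix_average_bound] cancels the one coming from the bound on the sum of all
    gaps. *)
Lemma last_gap_bound a e q M E : 0 <= a -> (0 < M)%N ->
  a * (1 + ln M%:R) <= 1 ->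
  (forall i, (i <= M)%N -> 0 <= e i) -> (forall i, (i < M)%N -> 0 <= q i) ->
  (forall k, (0 < k < M)%N ->
     \sum_(i < k) e i <= (1 + a) * k%:R * e k + \sum_(i < k) q i) ->
  0 <= E -> \sum_(i < M) e i <= E + \sum_(i < M) q i ->
  e 0 <= expR 1 * (E / M%:R + \sum_(i < M) q i / i.+1%:R).
Proof.
case: M => // m a0 _ aM e0 q0 H E0 HE.
apply: (le_trans (suffix_average_bound a0 e0 q0 H (ltnSn m))).
have m0 : (0 : R) < m.+1%:R by rewrite ltr0n.
apply: ler_pM.
- by apply: prodr_ge0 => i _; rewrite addr_ge0 // divr_ge0.
- rewrite -addrA addr_ge0 //.
    by rewrite divr_ge0 // sumr_ge0 // => i _; apply: e0; rewrite ltnW.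
  rewrite subr_ge0 mulr_suml; apply: ler_sum => i _; apply: ler_wpM2l.
    exact: q0.
  by rewrite lef_pV2 ?posrE ?ltr0n // ler_nat.
- apply: (le_trans (prod1D_le_expR _ a0)); rewrite ler_expR.
  apply: le_trans aM; apply: ler_wpM2l => //.
  apply: le_trans (harmonic_le_ln (ltn0Sn m)).
  by rewrite big_ord_recl lerDr.
- rewrite addrAC lerD2r -mulrBl ler_wpM2r ?invr_ge0 ?(ltW m0) //; lra.
Qed.

Lemma contraction_bound t b D r m : 0 <= t -> 0 <= b ->
  (forall k, (k < m)%N -> (1 + t) * D k.+1 <= D k + b * r k) ->
  D m <= (1 + t) ^- m * D 0 + b * \sum_(k < m) (1 + t) ^- (m - k) * r k.
Proof.
move=> t0 b0; have t1 : 0 < 1 + t by lra.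
elim: m => [|m IH] H; first by rewrite big_ord0 expr0 invr1; lra.
have {}IH := IH (fun k km => H k (ltnW km)).
have h : D m.+1 <= (1 + t)^-1 * (D m + b * r m).
  by rewrite mulrC ler_pdivlMr // mulrC H.
apply: (le_trans h); rewrite big_ord_recr /= subSnn expr1.
have -> : \sum_(i < m) (1 + t) ^- (m.+1 - i) * r i =
    (1 + t)^-1 * \sum_(i < m) (1 + t) ^- (m - i) * r i.
  rewrite mulr_sumr; apply: eq_bigr => i _.
  by rewrite subSn ?(ltnW (ltn_ord i)) // exprS invfM mulrA.
rewrite exprS invfM.
have : (1 + t)^-1 * D m <= (1 + t)^-1 *
    ((1 + t) ^- m * D 0 + b * \sum_(k < m) (1 + t) ^- (m - k) * r k).
  by rewrite ler_wpM2l // invr_ge0 ltW.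
lra.
Qed.

Lemma geometric_sum_le t m : 0 < t -> \sum_(k < m) (1 + t) ^- (m - k) <= t^-1.
Proof.
move=> t0; have t1 : 0 < 1 + t by lra.
suff : \sum_(k < m) (1 + t) ^- (m - k) = t^-1 * (1 - (1 + t) ^- m).
  move=> ->; apply: ler_piMr; first by rewrite invr_ge0 ltW.
  by rewrite gerBl invr_ge0 exprn_ge0 // ltW.
elim: m => [|m IH]; first by rewrite big_ord0 expr0 invr1 subrr mulr0.
rewrite big_ord_recr /= subSnn expr1.
have -> : \sum_(i < m) (1 + t) ^- (m.+1 - i) =
    (1 + t)^-1 * \sum_(i < m) (1 + t) ^- (m - i).
  rewrite mulr_sumr; apply: eq_bigr => i _.
  by rewrite subSn ?(ltnW (ltn_ord i)) // exprS invfM.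
rewrite IH exprS invfM; set y := (1 + t) ^- m.
by field; rewrite !gt_eqF.
Qed.

(** Since [(1 - t / 4) (1 + t) = 1 + t (3 - t) / 4], each factor [1 / (1 + t)] is at most
    [1 - t / 4] when [t <= 3]. *)
Lemma contraction_le_expR t m : 0 <= t <= 3 ->
  (1 + t) ^- m <= expR (- (t / 4 * m%:R)).
Proof.
move=> /andP[t0 t3]; have t1 : 0 < 1 + t by lra.
rewrite -mulNr mulrC expRM_natl -exprVn; apply: lerXn2r.
- by rewrite nnegrE invr_ge0 ltW.
- by rewrite nnegrE expR_ge0.
apply: le_trans (expR_ge1Dx _); rewrite -[X in X <= _]mul1r ler_pdivrMr //.
nra.
Qed.

(* The weight in the final bound of the residual of epoch [k], counted from 0:
   geometric while the distance contracts, harmonic in the second phase. *)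
Definition epoch_weight t K k : R :=
  if (k < K./2)%N then 2 / K%:R * (1 + t) ^- (K./2 - k) else (K - k)%:R^-1.

Lemma epoch_weight_ge0 t K k : 0 <= t -> 0 <= epoch_weight t K k.
Proof.
move=> t0; rewrite /epoch_weight; case: ifP => _; last by rewrite invr_ge0.
by rewrite mulr_ge0 ?divr_ge0 // invr_ge0 exprn_ge0 // addr_ge0.
Qed.

(** The second phase is listed backwards, the order in which [last_gap_bound] delivers it. *)
Lemma sum_epoch_weight_split t K r : \sum_(k < K) epoch_weight t K k * r k =
  2 / K%:R * (\sum_(k < K./2) (1 + t) ^- (K./2 - k) * r k)
  + \sum_(i < K - K./2) r (K - i.+1)%N / i.+1%:R.
Proof.
have hK : (K./2 <= K)%N by lia.
rewrite -(big_mkord xpredT (fun k => epoch_weight t K k * r k)).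
rewrite (@big_cat_nat _ _ _ K./2) //=; congr (_ + _).
  rewrite big_mkord mulr_sumr; apply: eq_bigr => k _.
  by rewrite /epoch_weight ltn_ord mulrA.
rewrite big_nat_rev /= -{1}(add0n K./2) big_addn big_mkord.
apply: eq_bigr => i _; have := ltn_ord i => iK.
have -> : (K./2 + K - (i + K./2).+1 = K - i.+1)%N by lia.
rewrite /epoch_weight ifF; last by apply/negbTE; rewrite -leqNgt; lia.
by rewrite mulrC; congr (_ / _%:R); lia.
Qed.

(** The geometric weights account for the term in [1 / (mu_F K)] of the final bounds, the harmonic
    ones for the factor [1 + log K]. *)
Lemma sum_epoch_weight_le t K : 0 < t -> (1 < K)%N ->
  \sum_(k < K) epoch_weight t K k <= 2 / (t * K%:R) + (1 + ln K%:R).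
Proof.
move=> t0 K1.
have -> : \sum_(k < K) epoch_weight t K k =
    \sum_(k < K) epoch_weight t K k * (fun=> 1) (nat_of_ord k).
  by apply: eq_bigr => k _; rewrite mulr1.
rewrite (sum_epoch_weight_split t K (fun=> 1)); apply: lerD.
  rewrite invfM [_^-1 * _^-1]mulrC mulrA; apply: ler_wpM2l; first by rewrite divr_ge0.
  by under eq_bigr do rewrite mulr1; exact: geometric_sum_le.
under eq_bigr do rewrite mul1r.
apply: le_trans (harmonic_le_ln (ltnW K1)).
have hK : (K - K./2 <= K)%N by lia.
rewrite (big_ord_widen _ (fun i => (i.+1%:R : R)^-1) hK) big_mkcond /=.
by apply: ler_sum => i _; case: ifP => // _; rewrite invr_ge0.
Qed.

(* The first [K./2] epochs contract the squared distance [D], the remaining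
   ones turn it into a bound on the last gap [delta K]. *)
Lemma two_phase_bound a t b (delta D r : nat -> R) K :
  0 <= a -> 0 <= t -> 0 < b -> (1 < K)%N -> a * (1 + ln K%:R) <= 1 ->
  (forall k, (k <= K)%N -> 0 <= delta k) -> (forall k, 0 <= D k) ->
  (forall k, (k < K)%N -> 0 <= r k) ->
  (forall k, (k < K)%N -> (1 + t) * D k.+1 <= D k + b * r k) ->
  (forall k, (k < K)%N -> b * delta k.+1 <= D k - D k.+1 + b * r k) ->
  (forall j, (0 < j < K)%N -> \sum_(j <= k < K) delta k.+1 <=
     (1 + a) * (K - j)%:R * delta j + \sum_(j <= k < K) r k) ->
  delta K <= expR 1 * (2 / (b * K%:R) * (1 + t) ^- K./2 * D 0
                       + \sum_(k < K) epoch_weight t K k * r k).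
Proof.
move=> a0 t0 b0 K1 aK delta0 D0 r0 Hc Hd Hs.
set m := K./2; have mK : (m < K)%N by rewrite /m; lia.
have m0 : (0 < m)%N by rewrite /m; lia.
have K0 : (0 : R) < K%:R by rewrite ltr0n; lia.
(* At least half of the epochs belong to the second phase: hence the factor [2 / K] in
   [epoch_weight]. *)
have KM : (K%:R : R) / 2 <= (K - m)%:R.
  rewrite ler_pdivrMr // -natrM ler_nat /m; lia.
have M0 : (0 : R) < (K - m)%:R by lra.
have rev (h : nat -> R) k : (k <= K)%N ->
    \sum_(i < k) h (K - i.+1)%N = \sum_(K - k <= i < K) h i.
  move=> kK; rewrite big_nat_rev /= -{1}(add0n (K - k)%N) big_addn.
  have -> : (K - (K - k) = k)%N by lia.
  rewrite big_mkord; apply: eq_bigr => i _; congr h; have := ltn_ord i; lia.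
have revS (h : nat -> R) k : (k <= K)%N ->
    \sum_(i < k) h (K - i)%N = \sum_(K - k <= i < K) h i.+1.
  move=> kK; rewrite -(rev (fun i => h i.+1)) //; apply: eq_bigr => i _.
  congr h; have := ltn_ord i; lia.
have step : delta K <= expR 1 *
    ((D m / b) / (K - m)%:R + \sum_(i < K - m) r (K - i.+1)%N / i.+1%:R).
  rewrite -{1}(subn0 K).
  (* Counting from 0, the epoch that produces [delta (K - i)] has index [K - i - 1]; hence the shift
     between gaps and residuals. *)
  apply: (@last_gap_bound a (fun i => delta (K - i)%N) (fun i => r (K - i.+1)%N)) => //.
  - lia.
  - apply: le_trans aK; apply: ler_wpM2l => //; rewrite lerD2l ler_ln ?posrE //.
    by rewrite ler_nat; lia.
  - by move=> i _; apply: delta0; lia.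
  - by move=> i iK; apply: r0; lia.
  - move=> k kK; rewrite revS ?rev; try lia.
    have := Hs (K - k)%N; have -> : (K - (K - k) = k)%N by lia.
    by apply; lia.
  - by rewrite divr_ge0 // ltW.
  - rewrite revS ?rev; try lia.
    have -> : (K - (K - m) = m)%N by lia.
    have : forall n, (m <= n <= K)%N ->
      \sum_(m <= i < n) delta i.+1 <= (D m - D n) / b + \sum_(m <= i < n) r i.
      elim=> [|n IH] /andP[mn nK]; first by move: mn m0; lia.
      move: mn; rewrite leq_eqVlt => /orP[/eqP <-|mn].
        by rewrite !big_geq // subrr mul0r addr0.
      rewrite ltnS in mn; rewrite !big_nat_recr //=.
      have h1 : delta n.+1 <= (D n - D n.+1) / b + r n.
        rewrite -(ler_pM2l b0) mulrDr mulrCA divff ?gt_eqF // mulr1.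
        exact: Hd.
      have := IH; rewrite mn (ltnW nK) => /(_ isT) h2.
      apply: (le_trans (lerD h2 h1)); rewrite addrACA -mulrDl.
      by apply: lerD => //; rewrite ler_wpM2r ?invr_ge0 ?(ltW b0) //; lra.
    move=> /(_ K); rewrite leqnn (ltnW mK) => /(_ isT) h.
    apply: (le_trans h); rewrite lerD2r ler_wpM2r ?invr_ge0 ?(ltW b0) //.
    by have := D0 K; lra.
apply: (le_trans step); rewrite ler_wpM2l ?expR_ge0 //.
rewrite sum_epoch_weight_split -/m addrA lerD2r.
have hD := @contraction_bound t b D r m t0 (ltW b0) (fun k km => Hc k (ltn_trans km mK)).
have h2 : D m / b / (K - m)%:R <= D m / b * (2 / K%:R).
  apply: ler_wpM2l; first by rewrite divr_ge0 // ltW.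
  by rewrite -[_^-1]mul1r ler_pdivrMr // mulrAC ler_pdivlMr //; lra.
apply: (le_trans h2).
have h3 : D m / b * (2 / K%:R) <=
   ((1 + t) ^- m * D 0 + b * \sum_(k < m) (1 + t) ^- (m - k) * r k) / b * (2 / K%:R).
  by rewrite ler_wpM2r ?divr_ge0 // ler_wpM2r ?invr_ge0 // ltW.
apply: (le_trans h3); rewrite le_eqVlt; apply/orP; left; apply/eqP.
set S := \sum_(k < m) _; set y := (1 + t) ^- m.
by field; rewrite !gt_eqF.
Qed.

End Sequences.

(** * Consequences of the stepsize condition *)

Lemma stepsize_bounds (R : realType) n (L : 'I_n -> R) (eta mu lk : R) :
  (0 < n)%N -> (forall i, 0 < L i) -> 1 <= lk -> 0 < eta ->
  eta <= (n%:R * Num.max (4 * Num.sqrt (2 * (n%:R^-1 * \sum_i L i) *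
            \big[Num.max/0]_i L i * lk)) mu)^-1 ->
  [/\ n%:R * eta * mu <= 1, 4 * eta * \sum_i L i <= 1
    & 32 * eta ^+ 2 * (\sum_i L i) ^+ 2 * lk <= 1].
Proof.
move=> n0 L0 lk1 eta0; have n0' : (0 : R) < n%:R by rewrite ltr0n.
set W := \sum_i L i; set M := \big[Num.max/0]_i L i.
have W0 : 0 < W.
  rewrite /W (bigD1 (Ordinal n0)) //= ltr_pwDl //.
  by rewrite sumr_ge0 // => i _; rewrite ltW.
(* Allows the product of mean and maximum under the root to be bounded below by the square of the
   mean. *)
have WM : n%:R^-1 * W <= M.
  rewrite mulrC ler_pdivrMr // /W -[n in n%:R]card_ord mulrC mulr_natl -sumr_const.
  by apply: ler_sum => i _; apply: le_bigmax.
have l0 : 0 < n%:R^-1 * W by rewrite mulr_gt0 ?invr_gt0.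
have M0 : 0 < M by exact: lt_le_trans l0 WM.
have lk0 : 0 < lk by lra.
have X0 : 0 < 2 * (n%:R^-1 * W) * M * lk by rewrite !mulr_gt0 ?invr_gt0.
set q := Num.sqrt _; have q0 : 0 < q by rewrite sqrtr_gt0.
set mx := Num.max _ _ => h.
have mx0 : 0 < mx by rewrite lt_max; apply/orP; left; lra.
have {}h : n%:R * eta * mx <= 1.
  by rewrite mulrAC -(ler_pdivlMl _ _ (mulr_gt0 n0' mx0)) mulr1.
have ne0 : 0 < n%:R * eta by rewrite mulr_gt0.
have h1 : n%:R * eta * mu <= 1.
  by apply: le_trans h; rewrite ler_pM2l // le_max lexx orbT.
have h2 : n%:R * eta * (4 * q) <= 1.
  by apply: le_trans h; rewrite ler_pM2l // le_max lexx.
have h3 : (n%:R * eta * (4 * q)) ^+ 2 <= 1.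
  by rewrite exprn_ile1 // mulr_ge0 //; lra.
have h4 : 32 * eta ^+ 2 * W ^+ 2 * lk <= 1.
  apply: le_trans h3; rewrite !exprMn sqr_sqrtr ?(ltW X0) //.
  have -> : 32 * eta ^+ 2 * W ^+ 2 * lk =
      n%:R ^+ 2 * eta ^+ 2 * (4 ^+ 2 * (2 * (n%:R^-1 * W) * (n%:R^-1 * W) * lk)).
    by field; rewrite gt_eqF.
  rewrite ler_wpM2l ?mulr_ge0 ?exprn_ge0 ?(ltW eta0) // ler_wpM2l ?exprn_ge0 //.
  by rewrite ler_pM2r // ler_wpM2l // mulr_ge0 // ltW.
split=> //.
have h5 : (4 * eta * W) ^+ 2 <= 1.
  have : eta ^+ 2 * W ^+ 2 <= eta ^+ 2 * W ^+ 2 * lk.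
    by rewrite ler_peMr // mulr_ge0 ?sqr_ge0.
  have := sqr_ge0 (eta * W); rewrite !exprMn; lra.
by rewrite -(expr_le1 (_ : 0 < 2)%N) // !mulr_ge0 // ltW.
Qed.

Lemma leq_half3 K : (1 < K)%N -> (K <= 3 * K./2)%N.
Proof. lia. Qed.

(** * Analysis of a whole run *)

Section Run.
Context {R : realType} {d n : nat}.
Variables (f : 'I_n -> 'rV[R]_d -> R) (gr : 'I_n -> 'rV[R]_d -> 'rV[R]_d).
Variables (L : 'I_n -> R) (psi : 'rV[R]_d -> \bar R) (mu_f mu_psi eta : R).
Variables (xstar x1 : 'rV[R]_d) (K : nat).
Hypotheses (n0 : (0 < n)%N) (fC : forall i, convex_fun (f i)).
Hypotheses (fG : forall i, has_gradient (f i) (gr i)) (L0 : forall i, 0 < L i).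
Hypotheses (gL : forall i, lipschitz_map (gr i) (L i)).
Hypotheses (psiP : proper_efun psi) (psiC : convex_efun psi).
Hypotheses (psiM : mu_psi_condition psi mu_psi) (xoo : (psi xstar < +oo)%E).
Hypothesis xmin : forall x, ((n%:R^-1 * \sum_i f i xstar)%:E + psi xstar
              <= (n%:R^-1 * \sum_i f i x)%:E + psi x)%E.
Hypotheses (eta0 : 0 < eta) (etaL : 4 * eta * \sum_i L i <= 1).
Hypotheses (K2 : (2 <= K)%N).
Hypothesis etaLK : 32 * eta ^+ 2 * (\sum_i L i) ^+ 2 * (1 + ln K%:R) <= 1.
Hypothesis mu_f0 : 0 <= mu_f.
Hypothesis fM : forall x y, mu_f / 2 * dotv (x - y) (x - y) <=
  mean_fun f x - mean_fun f y - dotv (mean_grad gr y) (x - y).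
Hypotheses (muF0 : 0 < mu_f + 2 * mu_psi) (x1oo : (psi x1 < +oo)%E).
Hypothesis eta_mu : n%:R * eta * mu_psi <= 1.

Local Notation F := (objective f psi).
Local Notation r := (shuffle_residual L (fun i => gr i xstar) eta).
Let W := \sum_i L i.
Let a := 24 * eta ^+ 2 * W ^+ 2.
Let t := n%:R * eta * (mu_f + 2 * mu_psi).
Let b := 2 * n%:R * eta.

Let nR0 : (0 : R) < n%:R. Proof. by rewrite ltr0n. Qed.
Let b0 : 0 < b. Proof. by rewrite /b !mulr_gt0. Qed.
Let t0 : 0 < t. Proof. by rewrite /t !mulr_gt0. Qed.
Let a0 : 0 <= a. Proof. by rewrite /a mulr_ge0 ?sqr_ge0 // mulr_ge0 ?sqr_ge0. Qed.
Let lnK0 : 0 <= ln (K%:R : R). Proof. by rewrite ln_ge0 // ler1n ltnW. Qed.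
Let mu_psi0 : 0 <= mu_psi. Proof. exact: psiM.1. Qed.

Let aK : a * (1 + ln K%:R) <= 1.
Proof.
apply: le_trans etaLK; rewrite ler_wpM2r ?addr_ge0 //.
rewrite /a -/W -!mulrA; have := sqr_ge0 (eta * W); rewrite exprMn; lra.
Qed.

Let a1 : a <= 1.
Proof. by apply: le_trans aK; rewrite ler_peMr // lerDl. Qed.

Section FixedRun.
Variables (sigma : nat -> {perm 'I_n}) (x : nat -> 'rV[R]_d).
Hypothesis run : prox_shuffling_run gr psi eta K sigma x1 x.

Lemma run_fin k : (k <= K)%N -> (psi (x k.+1) < +oo)%E.
Proof.
move=> kK; case: k kK => [|k] kK; first by rewrite run.1.
exact: (prox_point_fin psiP n0 (run.2 k.+1 kK) x1oo).
Qed.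

(** The index is shifted because the run starts at [x 1] and the sequences of [two_phase_bound] at
    0. *)
Let dist2 k z := dotv (z - x k.+1) (z - x k.+1).

Lemma run_step k z : (k < K)%N -> (psi z < +oo)%E ->
  b * (F (x k.+2) - F z) <=
  dist2 k z - (1 + n%:R * eta * mu_psi) * dist2 k.+1 z
  + b * (a * (F z - F xstar) + r (sigma k.+1)).
Proof.
move=> kK zoo; apply: (epoch_progress n0 fC fG L0 gL psiP psiC psiM xoo xmin) => //.
  exact: (@run_fin k.+1).
exact: run.2.
Qed.

Lemma run_gap_ge k : (k <= K)%N ->
  (mu_f + mu_psi) / 2 * dist2 k xstar <= F (x k.+1) - F xstar.
Proof.
move=> /run_fin xk.
have := objective_growth n0 fC fG L0 gL psiP psiC psiM xoo xmin xk.
have := fM (x k.+1) xstar.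
have -> : dist2 k xstar = dotv (x k.+1 - xstar) (x k.+1 - xstar).
  by rewrite /dist2 -opprB dotvNl dotvNr opprK.
lra.
Qed.

Lemma run_last_gap : F (x K.+1) - F xstar <=
  expR 1 * (2 / (b * K%:R) * (1 + t) ^- K./2 * dotv (xstar - x1) (xstar - x1)
            + \sum_(k < K) epoch_weight t K k * r (sigma k.+1)).
Proof.
have dist0 k z : 0 <= dist2 k z by exact: dotvv_ge0.
have gap0 k : (k <= K)%N -> 0 <= F (x k.+1) - F xstar.
  move=> kK; apply: le_trans (run_gap_ge kK).
  by rewrite mulr_ge0 ?dist0 // divr_ge0 // addr_ge0.
rewrite -run.1.
apply: (@two_phase_bound R a t b (fun k => F (x k.+1) - F xstar) (dist2^~ xstar)
  (fun k => r (sigma k.+1))) => //.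
- exact: ltW.
- by move=> k _; apply: shuffle_residual_ge0 => i; exact: ltW.
(* The growth bound adds [n eta (mu_f + mu_psi)] to the [n eta mu_psi] of the epoch inequality; this
   is how [mu_f + 2 * mu_psi] arises. *)
- move=> k kK; have h1 := run_step kK xoo; have h2 := run_gap_ge kK.
  rewrite subrr mulr0 add0r in h1.
  have : b * ((mu_f + mu_psi) / 2 * dist2 k.+1 xstar) <= b * (F (x k.+2) - F xstar).
    by rewrite ler_pM2l.
  rewrite /t /b in h1 *; lra.
- move=> k kK; have h1 := run_step kK xoo; rewrite subrr mulr0 add0r in h1.
  have : 0 <= n%:R * eta * mu_psi * dist2 k.+1 xstar.
    by rewrite !mulr_ge0 // ltW.
  lra.
(* With [z = x j.+1] the distance is zero at the start and then telescopes, while each epoch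
   contributes [(1 + a) * dj]. The term [- dist2 m] is kept for the induction and dropped at
   [m = K]. *)
- move=> j /andP[j0 jK]; have zoo := run_fin (ltnW jK).
  set dj := F (x j.+1) - F xstar.
  suff H m : (j <= m <= K)%N -> b * \sum_(j <= k < m) (F (x k.+2) - F xstar) <=
      b * ((1 + a) * (m - j)%:R * dj + \sum_(j <= k < m) r (sigma k.+1)) - dist2 m (x j.+1).
    rewrite -(ler_pM2l b0); apply: (le_trans (H K _)); first by rewrite leqnn ltnW.
    by rewrite gerBl dist0.
  elim: m => [|m IH] /andP[jm mK]; first by move: jm; rewrite leqNgt j0.
  move: jm; rewrite leq_eqVlt => /orP[/eqP <-|jm].
    by rewrite !big_geq // subnn /dist2 subrr dot0v; lra.
  rewrite ltnS in jm; rewrite !big_nat_recr //= subSn // -natr1.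
  have h1 := run_step mK zoo.
  have h2 : b * \sum_(j <= k < m) (F (x k.+2) - F xstar) <=
      b * ((1 + a) * (m - j)%:R * dj + \sum_(j <= k < m) r (sigma k.+1)) - dist2 m (x j.+1).
    by apply: IH; rewrite jm ltnW.
  have h3 : 0 <= n%:R * eta * mu_psi * dist2 m.+1 (x j.+1).
    by rewrite !mulr_ge0 // ltW.
  have e : F (x m.+2) - F (x j.+1) = (F (x m.+2) - F xstar) - dj by rewrite /dj; ring.
  rewrite e -/dj in h1.
  move: h1 h2 h3; set S1 := \sum_(j <= k < m) _; set S2 := \sum_(j <= k < m) _.
  move: (F (x m.+2) - F xstar) ((m - j)%:R : R) (r _) => y1 y2 y3; lra.
Qed.

Lemma run_last_gap_expR : F (x K.+1) - F xstar <= expR 1 *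
  (enorm (xstar - x1) ^+ 2 / (n%:R * eta * K%:R)
     * expR (- (12^-1 * n%:R * eta * (mu_f + 2 * mu_psi) * K%:R))
   + \sum_(k < K) epoch_weight t K k * r (sigma k.+1)).
Proof.
have K0 : (0 : R) < K%:R by rewrite ltr0n ltnW.
apply: (le_trans run_last_gap); rewrite ler_pM2l ?expR_gt0 // lerD2r sqr_enorm.
(* For [D = 0] both sides vanish. Otherwise strong convexity and smoothness between [x1] and [xstar]
   can be compared after division by [D], which bounds [mu_f] and hence [t]. *)
set D := dotv _ _; have [->|D0] := eqVneq D 0; first by rewrite mulr0 !mul0r.
have {}D0 : 0 < D by rewrite lt_def D0 dotvv_ge0.
have mu_fW : mu_f <= 2 * (n%:R^-1 * W).
  have := mean_descent n0 fC fG L0 gL x1 xstar; have := fM xstar x1.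
  rewrite -/D -/W => h1 h2; rewrite -(ler_pM2r D0); lra.
have t3 : t <= 3.
  have : n%:R * eta * mu_f <= n%:R * eta * (2 * (n%:R^-1 * W)).
    by rewrite ler_pM2l // mulr_gt0.
  have -> : n%:R * eta * (2 * (n%:R^-1 * W)) = 2 * eta * W.
    by field; rewrite gt_eqF.
  by rewrite /t; move: etaL eta_mu; rewrite -/W mulrDr (mulrCA _ 2); lra.
have -> : 2 / (b * K%:R) * (1 + t) ^- K./2 * D =
    D / (n%:R * eta * K%:R) * (1 + t) ^- K./2.
  rewrite /b; set y := _ ^- _; field.
  by rewrite !gt_eqF.
rewrite ler_wpM2l ?divr_ge0 ?mulr_ge0 ?(ltW D0) ?(ltW eta0) //.
apply: (le_trans (contraction_le_expR _ _)); first by rewrite (ltW t0).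
rewrite ler_expR lerN2.
(* The 12 in the exponent is [4 * 3]: rate [t / 4] per contracting epoch, and at least a third of
   the epochs contract. *)
have hK : (K%:R : R) <= 3 * K./2%:R by rewrite -natrM ler_nat leq_half3.
have : t / 12 * K%:R <= t / 12 * (3 * K./2%:R) by rewrite ler_pM2l // divr_gt0.
by rewrite /t; lra.
Qed.

End FixedRun.

(** Serves both permutation models: [rb] may hold the residuals of one run or their expectations, as
    only a uniform bound enters. *)
Lemma weighted_residual_le A X (rb : nat -> R) : 0 <= A -> 0 <= X ->
  (forall k, (k < K)%N -> rb k <= 12 * X) ->
  expR 1 * (A + \sum_(k < K) epoch_weight t K k * rb k) <=
  24 * expR 1 * (A + X / (t * K%:R) + X * (1 + ln K%:R)).
Proof.
move=> A0 X0 hr; rewrite (mulrC 24) -mulrA ler_pM2l ?expR_gt0 //.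
have h1 : \sum_(k < K) epoch_weight t K k * rb k <=
    (2 / (t * K%:R) + (1 + ln K%:R)) * (12 * X).
  apply: (@le_trans _ _ ((\sum_(k < K) epoch_weight t K k) * (12 * X))).
    rewrite mulr_suml; apply: ler_sum => k _; apply: ler_wpM2l; last exact: hr.
    exact/epoch_weight_ge0/ltW.
  by rewrite ler_wpM2r ?mulr_ge0 // sum_epoch_weight_le.
have h2 : 0 <= X * (1 + ln K%:R) by rewrite mulr_ge0 // addr_ge0.
move: h1 h2; rewrite mulrDl; move: (ln _) => lK.
have -> : 2 / (t * K%:R) * (12 * X) = 24 * (X / (t * K%:R)) by ring.
lra.
Qed.

End Run.

(** * Expectation over the permutations and the final bounds *)

Lemma sum_marginal (R : realType) (S T : finType) (p : S -> R) (h : S -> T) (q : R)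
    (u : T -> R) :
  (forall y, \sum_(s | h s == y) p s = q) -> \sum_s p s * u (h s) = q * \sum_y u y.
Proof.
move=> H; rewrite (partition_big h xpredT) //= mulr_sumr; apply: eq_bigr => y _.
by rewrite -(H y) mulr_suml; apply: eq_bigr => s /eqP <-.
Qed.

Theorem theorem4p2 (R : realType) :
  exists C c : R, 0 < C /\ 0 < c /\
  forall (d n : nat) (f : 'I_n -> 'rV[R]_d -> R) (gr : 'I_n -> 'rV[R]_d -> 'rV[R]_d)
    (L : 'I_n -> R) (psi : 'rV[R]_d -> \bar R) (mu_f mu_psi : R)
    (xstar x1 : 'rV[R]_d) (K : nat) (eta : R),
  (0 < n)%N ->
  (forall i, convex_fun (f i)) ->
  (forall i, has_gradient (f i) (gr i)) ->
  (forall i, 0 < L i) ->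
  (forall i, lipschitz_map (gr i) (L i)) ->
  proper_efun psi -> closed_efun psi -> convex_efun psi ->
  (* f := 1/n sum f_i is mu_f-strongly convex *)
  0 <= mu_f ->
  (forall x y,
     n%:R^-1 * (\sum_i f i x) - n%:R^-1 * (\sum_i f i y)
       - dotv (n%:R^-1 *: \sum_i gr i y) (x - y)
     >= mu_f / 2 * enorm (x - y) ^+ 2) ->
  mu_psi_condition psi mu_psi ->
  0 < mu_f + 2 * mu_psi ->
  (* x_* minimizes F = f + psi, with finite value *)
  (psi xstar < +oo)%E ->
  (forall x, ((n%:R^-1 * \sum_i f i xstar)%:E + psi xstar
              <= (n%:R^-1 * \sum_i f i x)%:E + psi x)%E) ->
  (psi x1 < +oo)%E ->
  (2 <= K)%N ->
  let Lbar := n%:R^-1 * \sum_i L i in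
  let Lmax := \big[Num.max/0]_i L i in
  let muF := mu_f + 2 * mu_psi in
  let Fun x := ((n%:R^-1 * \sum_i f i x)%:E + psi x)%E in
  let Fstar := n%:R^-1 * (\sum_i f i xstar) + fine (psi xstar) in
  let D := enorm (xstar - x1) in
  let s2any := n%:R^-1 * \sum_i enorm (gr i xstar) ^+ 2 in
  let s2rand := s2any + n%:R * enorm (n%:R^-1 *: \sum_i gr i xstar) ^+ 2 in
  let logK := 1 + ln (K%:R) in
  0 < eta ->
  eta <= (n%:R * Num.max (4 * Num.sqrt (2 * Lbar * Lmax * logK)) mu_psi)^-1 ->
  (* (i) arbitrary permutations *)
  (forall (sigma : nat -> {perm 'I_n}) (x : nat -> 'rV[R]_d),
     prox_shuffling_run gr psi eta K sigma x1 x ->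
     (Fun (x K.+1) - Fstar%:E <=
       (C * (D ^+ 2 / (n%:R * eta * K%:R) * expR (- (c * n%:R * eta * muF * K%:R))
             + n%:R * eta * Lbar * s2any / (muF * K%:R)
             + (n%:R * eta) ^+ 2 * Lbar * s2any * logK))%:E)%E)
  /\
  (* (ii) uniformly random permutations: p is the joint law of (sigma_1,...,sigma_K),
     with arbitrary dependence but each sigma_k uniform on the n! permutations *)
  (forall (p : K.-tuple {perm 'I_n} -> R)
          (x : K.-tuple {perm 'I_n} -> nat -> 'rV[R]_d),
     (forall s, 0 <= p s) -> \sum_s p s = 1 ->
     (forall (k : 'I_K) (pi : {perm 'I_n}),
        \sum_(s | tnth s k == pi) p s = (n`!)%:R^-1) ->
     (forall s : K.-tuple {perm 'I_n}, prox_shuffling_run gr psi eta K (fun k => nth 1%g (tval s) k.-1) x1 (x s)) ->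
     (\sum_s (p s)%:E * (Fun (x s K.+1) - Fstar%:E) <=
       (C * (D ^+ 2 / (n%:R * eta * K%:R) * expR (- (c * n%:R * eta * muF * K%:R))
             + eta * Lbar * s2rand / (muF * K%:R)
             + n%:R * eta ^+ 2 * Lbar * s2rand * logK))%:E)%E).
Proof.
(* The constants of [weighted_residual_le] and [run_last_gap_expR]. *)
exists (24 * expR 1), 12^-1; split; first by rewrite mulr_gt0 ?expR_gt0.
split; first by rewrite invr_gt0.
move=> d n f gr L psi mu_f mu_psi xstar x1 K eta n0 fC fG L0 gL psiP _ psiC mu_f0 fM psiM.
move=> muF0 xoo xmin x1oo K2 Lbar Lmax muF Fun Fstar D s2any s2rand logK eta0 heta.
have n0' : (0 : R) < n%:R by rewrite ltr0n.
have K0 : (0 : R) < K%:R by rewrite ltr0n ltnW.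
have lnK0 : 0 <= ln (K%:R : R) by rewrite ln_ge0 // ler1n ltnW.
have lk1 : 1 <= 1 + ln (K%:R : R) by rewrite lerDl.
have [eta_mu etaL etaLK] := stepsize_bounds n0 L0 lk1 eta0 heta.
have {}fM x y : mu_f / 2 * dotv (x - y) (x - y) <=
    mean_fun f x - mean_fun f y - dotv (mean_grad gr y) (x - y).
  by rewrite -sqr_enorm; exact: fM.
set t := n%:R * eta * muF.
have t0 : 0 < t by rewrite /t !mulr_gt0.
pose r := shuffle_residual L (fun i => gr i xstar) eta.
have FunE x : (psi x < +oo)%E ->
    (Fun x - Fstar%:E)%E = (objective f psi x - objective f psi xstar)%:E.
  by move=> h; rewrite /Fun -(proper_fineK psiP h).
set A := D ^+ 2 / (n%:R * eta * K%:R) * expR (- (12^-1 * n%:R * eta * muF * K%:R)).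
have A0 : 0 <= A.
  rewrite mulr_ge0 ?expR_ge0 // divr_ge0 ?sqr_ge0 // !mulr_ge0 //; exact: ltW.
have gap sigma x : prox_shuffling_run gr psi eta K sigma x1 x ->
    objective f psi (x K.+1) - objective f psi xstar <=
    expR 1 * (A + \sum_(k < K) epoch_weight t K k * r (sigma k.+1)).
  move=> run; exact: (run_last_gap_expR n0 fC fG L0 gL psiP psiC psiM xoo xmin eta0 etaL
    K2 etaLK mu_f0 fM muF0 x1oo eta_mu run).
have fin sigma x : prox_shuffling_run gr psi eta K sigma x1 x -> (psi (x K.+1) < +oo)%E.
  by move=> run; exact: (run_fin n0 psiP x1oo run (leqnn K)).
have WE : \sum_i L i = n%:R * Lbar by rewrite mulVKf ?gt_eqF.
have Lbar0 : 0 <= Lbar.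
  by rewrite mulr_ge0 ?invr_ge0 // sumr_ge0 // => i _; exact: ltW.
have s2any0 : 0 <= s2any.
  by rewrite mulr_ge0 ?invr_ge0 // sumr_ge0 // => i _; exact: sqr_ge0.
have S2E : \sum_i dotv (gr i xstar) (gr i xstar) = n%:R * s2any.
  by rewrite mulVKf ?gt_eqF //; apply: eq_bigr => i _; rewrite sqr_enorm.
have s2rand0 : 0 <= s2rand by rewrite addr_ge0 // mulr_ge0 ?sqr_ge0.
have L0' i : 0 <= L i by exact: ltW.
split=> [sigma x run|p x p0 p1 pu run].
  rewrite FunE ?(fin _ _ run) // lee_fin; apply: (le_trans (gap _ _ run)).
  pose X := (n%:R * eta) ^+ 2 * Lbar * s2any.
  have X0 : 0 <= X by rewrite mulr_ge0 // mulr_ge0 ?sqr_ge0.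
  have -> : n%:R * eta * Lbar * s2any / (muF * K%:R) = X / (t * K%:R).
    by rewrite /X /t; field; rewrite !gt_eqF.
  apply: (weighted_residual_le n0 eta0 K2 muF0 (rb := fun k => r (sigma k.+1))) => // k kK.
  apply: (le_trans (shuffle_residual_le _ L0' _ _ n0)).
  rewrite WE S2E /X.
  have -> : 6 * eta ^+ 2 * (n%:R * Lbar) * (n%:R * s2any) =
    6 * ((n%:R * eta) ^+ 2 * Lbar * s2any) by ring.
  by rewrite -/X ler_wpM2r // ler_nat.
rewrite (eq_bigr (fun s => (p s * (objective f psi (x s K.+1) - objective f psi xstar))%:E));
  last by move=> s _; rewrite FunE ?(fin _ _ (run s)).
rewrite sumEFin lee_fin.
pose X := n%:R * eta ^+ 2 * Lbar * s2rand.
have X0 : 0 <= X by rewrite mulr_ge0 // mulr_ge0 // mulr_ge0 ?sqr_ge0 // ltW.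
have -> : eta * Lbar * s2rand / (muF * K%:R) = X / (t * K%:R).
  by rewrite /X /t; field; rewrite !gt_eqF.
(* Expected residual of an epoch. The weights are deterministic, so expectation passes inside the
   sum over epochs and one marginal of [p] enters at a time. *)
pose rb (k : nat) := \sum_s p s * r (nth 1%g (tval s) k).
apply: (@le_trans _ _ (expR 1 * (A + \sum_(k < K) epoch_weight t K k * rb k))).
  apply: (@le_trans _ _ (\sum_s p s * (expR 1 * (A +
      \sum_(k < K) epoch_weight t K k * r (nth 1%g (tval s) k))))).
    by apply: ler_sum => s _; apply: ler_wpM2l => //; exact: gap (run s).
  rewrite le_eqVlt; apply/orP; left; apply/eqP.
  under eq_bigr => s _ do rewrite mulrCA mulrDr mulr_sumr.
  rewrite -mulr_sumr big_split /= -mulr_suml p1 mul1r exchange_big /=.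
  congr (_ * (_ + _)); apply: eq_bigr => k _; rewrite mulr_sumr.
  by apply: eq_bigr => s _; rewrite mulrCA.
apply: (weighted_residual_le n0 eta0 K2 muF0 (rb := rb)) => // k kK.
have -> : rb k = (n`!)%:R^-1 * \sum_s r s.
  rewrite -(sum_marginal _ (pu (Ordinal kK))); apply: eq_bigr => s _.
  by rewrite (tnth_nth 1%g).
apply: (le_trans (shuffle_residual_mean_le _ L0' _ n0)).
(* With this form [G2 + S2] equals [n * s2rand], so the bound on the mean residual is exactly
   [12 * X]. *)
have -> : dotv (\sum_i gr i xstar) (\sum_i gr i xstar) =
    n%:R ^+ 2 * enorm (n%:R^-1 *: \sum_i gr i xstar) ^+ 2.
  by rewrite sqr_enorm dotvZl dotvZr; field; rewrite gt_eqF.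
rewrite WE S2E /X /s2rand le_eqVlt; apply/orP; left; apply/eqP.
by field; rewrite gt_eqF.
Qed.
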